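(* Let $B\in L^{\hat U}$, set $\mathcal A=B+\mathcal C$, and assume $(B+\mathcal C)\cap \mathrm{core}\,\mathcal D\neq\emptyset$. Then $$\sup_{X\in\mathcal A} I_U(X)=\sup_{X\in \mathrm{cl}^{\star}\mathcal A} I_U(X)=\sup_{X\in\mathcal A\cap\mathcal D} I_U(X)=\sup_{X\in\mathrm{cl}^{\circledast}(\mathcal A\cap\mathcal D)} I_U(X)=\min_{Y\in L^{\hat V}_+}\left\{I_V(Y)+\delta^{\circledast}_{\mathcal A\cap\mathcal D}(Y)\right\},$$ where the minimum is attained and, for $\mathcal G\subseteq L^{\hat U}$, $\delta^{\circledast}_{\mathcal G}(Y)=\sup_{X\in\mathcal G}E[XY]$.
   Context: Utility. $U:\mathbb R\to[-\infty,\infty)$ is proper, concave, non-decreasing and upper semicontinuous; $\mathrm{dom}\,U=\{x: U(x)>-\infty\}$, $\underline x=\inf \mathrm{dom}\,U$, $U(\infty)=\lim_{x\to\infty}U(x)$, $\overline x=\inf\{x: U(x)=U(\infty)\}$. Standing convention: $\underline x<0<\overline x$ and $U(0)=0$. Let $V(y)=\sup_{x\in\mathbb R}\{U(x)-xy\}\in[0,\infty]$, $\hat U(x)=-U(-|x|)$ and $\hat V(y)=\sup_{x\in\mathbb R}\{xy-\hat U(x)\}$ (a conjugate pair of Young functions, possibly taking the value $+\infty$). Orlicz spaces. On the probability space $(\Omega,\mathcal F_T,P)$, for $\Phi\in\{\hat U,\hat V\}$: $L^{\Phi}=\{X\in L^0: E[\Phi(\lambda X)]<\infty\text{ for some }\lambda>0\}$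 with norm $\|X\|_\Phi=\inf\{\lambda>0: E[\Phi(X/\lambda)]\le1\}$; $L^\Phi_+$ is its cone of non-negative elements. For $X\in L^{\hat U}$, $Y\in L^{\hat V}$ the product $XY$ is integrable. $I_f(X)=E[f(X)]$; $I_U$ takes values in $[-\infty,\infty)$ on $L^{\hat U}$. $\mathcal D=\mathrm{dom}\,I_U=\{X\in L^{\hat U}: I_U(X)>-\infty\}$ and $\mathrm{core}\,\mathcal D=\{X\in L^{\hat U}:\exists\lambda>1,\ I_U(\lambda X)>-\infty\}$. Market. $(\Omega,(\mathcal F_t)_{t\in[0,T]},P)$ is a filtered probability space, $S$ a (finite-dimensional) semimartingale, $L(S)$ the set of predictable $S$-integrable processes, $H\cdot S_t=\int_{(0,t]}H\,dS$. Tame strategies: $\mathscr T=\{H\in L(S):\inf_{t\in[0,T]}H\cdot S_t\in L^{\hat U}\}$. $\mathcal K=\{H\cdot S_T: H\in\mathscr T\}$, and $\mathcal C=(\mathcal K-L^0_+)\cap L^{\hat U}$ (a convex cone). Closures. $\mathrm{cl}^{\star}$ is closure in the norm topology of $L^{\hat U}$; $\mathrm{cl}^{\circledast}$ is closure of a convex set in (any) topology on $L^{\hat U}$ compatible with the dual pair $(L^{\hat U},L^{\hat V})$ under $\langle X,Y\rangle=E[XY]$, e.g. $\sigma(L^{\hat U},L^{\hat V})$. *)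

(* Defs.v *)
From HB Require Import structures.
From mathcomp Require Import all_boot all_order all_algebra.
From mathcomp Require Import all_classical all_reals all_analysis.

Set Implicit Arguments.
Unset Strict Implicit.
Unset Printing Implicit Defensive.

Import Order.TTheory GRing.Theory Num.Theory.
Import numFieldNormedType.Exports.

Local Open Scope classical_set_scope.
Local Open Scope ring_scope.

Section Utility.
Context {R : realType}.
Local Open Scope ereal_scope.
Implicit Types (U : R -> \bar R) (x y : R).

Definition edom U : set R := [set x | -oo < U x].

Definition value_at_infinity U : \bar R := lim (U x @[x --> +oo%R]).

(* On a function with values in [-oo, +oo[ the sum in [ut_concave] is never
   of the form oo - oo, and 0 * -oo = 0. *)
Record utility U : Prop := Utility {
  ut_lty : forall x, U x < +oo;
  ut_proper : edom U !=set0;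
  ut_concave : forall x y (t : R), (0 <= t <= 1)%R ->
    t%:E * U x + (1 - t)%:E * U y <= U (t * x + (1 - t) * y)%R;
  ut_nondecreasing : {homo U : x y / (x <= y)%R >-> x <= y};
  ut_usc : lower_semicontinuous (fun x => - U x);
  ut_dom_inf : ereal_inf (EFin @` edom U) < 0;
  ut_sat_inf : 0 < ereal_inf (EFin @` [set x | U x = value_at_infinity U]);
  ut_at0 : U 0%R = 0 }.

Definition conjV U y : \bar R := ereal_sup [set U x - (x * y)%:E | x in setT].

Definition Uhat U x : \bar R := - U (- `|x|)%R.

Definition Vhat U y : \bar R :=
  ereal_sup [set (x * y)%:E - Uhat U x | x in setT].

End Utility.

(* Random variables are measurable functions, not identified when they are
   equal almost surely; all the sets of random variables below are stable
   under almost sure equality. *)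
Section Orlicz.
Context {R : realType} {dsp : measure_display} {Omega : measurableType dsp}.
Variable P : probability Omega R.
Implicit Types (Phi f : R -> \bar R) (X Y Z : Omega -> R).
Implicit Types (G : set (Omega -> R)).

Definition L0_plus : set (Omega -> R) :=
  [set X : Omega -> R | measurable_fun setT X /\ {ae P, forall w, 0 <= X w}].

Definition If f X : \bar R := \int[P]_w f (X w).

Definition orlicz Phi : set (Omega -> R) :=
  [set X : Omega -> R | measurable_fun setT X /\
    exists2 l : R, 0 < l & (If Phi (fun w => (l * X w)%R) < +oo)%E].

Definition orlicz_norm Phi X : R :=
  inf [set l : R | 0 < l /\ (If Phi (fun w => (X w / l)%R) <= 1)%E].

Definition orlicz_plus Phi : set (Omega -> R) := orlicz Phi `&` L0_plus.

Definition norm_closure Phi G : set (Omega -> R) :=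
  [set X : Omega -> R | orlicz Phi X /\
    forall eps : R, 0 < eps -> exists2 Z, G Z & orlicz_norm Phi (X \- Z) < eps].

(* closure in sigma(L^Phi, L^Psi) for the pairing <X, Y> = E[XY] *)
Definition weak_closure Phi Psi G : set (Omega -> R) :=
  [set X : Omega -> R | orlicz Phi X /\
    forall (n : nat) (Y : 'I_n -> Omega -> R) (eps : R),
      (forall i, orlicz Psi (Y i)) -> 0 < eps ->
      exists2 Z, G Z &
        forall i, (`| 'E_P[((X \- Z) \* Y i)%R] | < eps%:E)%E].

Definition support_fun G Y : \bar R := ereal_sup [set 'E_P[(X \* Y)%R]%E | X in G].

Definition domI (U : R -> \bar R) : set (Omega -> R) :=
  [set X : Omega -> R | orlicz (Uhat U) X /\ (-oo < If U X)%E].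

Definition coreI (U : R -> \bar R) : set (Omega -> R) :=
  [set X : Omega -> R | orlicz (Uhat U) X /\
    exists2 l : R, 1 < l & (-oo < If U (fun w => (l * X w)%R))%E].

End Orlicz.

Section StochasticIntegral.
Context {R : realType} {dsp : measure_display} {Omega : measurableType dsp}.
Variables (P : probability Omega R) (T : R) (F : R -> set (set Omega)).

Local Notation process := (R -> Omega -> R).
Implicit Types (s t a b : R).

Definition filtration : Prop :=
  [/\ forall t, 0 <= t <= T -> sigma_algebra setT (F t),
      forall s t, 0 <= s -> s <= t -> t <= T -> F s `<=` F t
    & F T = measurable].

Definition measurable_wrt (G : set (set Omega)) (X : Omega -> R) : Prop :=
  measurable_fun setT (X : g_sigma_algebraType G -> R).

Definition adapted (X : process) : Prop :=
  forall t, 0 <= t <= T -> measurable_wrt (F t) (X t).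

Definition cadlag_paths (X : process) : Prop :=
  forall w t,
    (0 <= t < T -> X s w @[s --> t^'+] --> X t w) /\
    (0 < t <= T -> cvg (X s w @[s --> t^'-])).

Definition stopping_time (tau : Omega -> R) : Prop :=
  (forall w, 0 <= tau w) /\
  forall t, 0 <= t <= T -> F t [set w | tau w <= t].

Definition stopped (X : process) (tau : Omega -> R) : process :=
  fun t w => X (Num.min (tau w) t) w.

Definition martingale (M : process) : Prop :=
  [/\ adapted M,
      forall t, 0 <= t <= T -> P.-integrable setT (EFin \o M t)
    & forall s t A, 0 <= s -> s <= t -> t <= T -> F s A ->
        (\int[P]_(w in A) (M t w)%:E = \int[P]_(w in A) (M s w)%:E)%E].

(* Since the horizon is [0, T], "tau n increases to infinity" becomes
   "tau n >= T for n large enough". *)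
Definition local_martingale (M : process) : Prop :=
  exists tau : nat -> Omega -> R,
    [/\ forall n, stopping_time (tau n),
        forall n w, tau n w <= tau n.+1 w,
        {ae P, forall w, exists n, T <= tau n w}
      & forall n, martingale (stopped M (tau n))].

Definition semimartingale (X : process) : Prop :=
  adapted X /\
  exists M A : process,
    [/\ adapted M /\ cadlag_paths M /\ local_martingale M,
        adapted A /\ cadlag_paths A /\
          (forall w, bounded_variation 0 T (A ^~ w)),
        forall w, M 0 w = 0 /\ A 0 w = 0
      & forall t w, 0 <= t <= T -> X t w = X 0 w + M t w + A t w].

(* The predictable sigma-algebra on [0, T] x Omega is generated by these
   rectangles. *)
Definition predictable_rectangles : set (set (R * Omega)) :=
  [set D | (exists2 A, F 0 A & D = [set 0] `*` A) \/
           (exists a b A, [/\ 0 <= a, a <= b, b <= T, F a A &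
                              D = `]a, b] `*` A])].

Definition predictable (H : process) : Prop :=
  measurable_fun
    ([set p | 0 <= p.1 <= T] : set (g_sigma_algebraType predictable_rectangles))
    (fun p => H p.1 p.2).

(* The summand coef * 1_{]lo, hi]} of an elementary predictable process. *)
Record elem_term := ElemTerm {
  lo : R;
  hi : R;
  coef : Omega -> R;
  lo_ge0 : 0 <= lo;
  lo_le_hi : lo <= hi;
  hi_leT : hi <= T;
  coef_measurable : measurable_wrt (F lo) coef;
  coef_bounded : exists C : R, forall w, `|coef w| <= C }.

(* A list of terms represents their sum; the intervals may overlap. *)
Definition elem_process (e : seq elem_term) : process :=
  fun t w => \sum_(p <- e) if lo p < t <= hi p then coef p w else 0.

Definition elem_integral (e : seq elem_term) (X : process) : process :=
  fun t w => \sum_(p <- e)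
    coef p w * (X (Num.min (hi p) t) w - X (Num.min (lo p) t) w).

(* Convergence in Emery's semimartingale topology on [0, T]:
   sup_t |(X_n - X)_0 + phi . (X_n - X)_t| tends to 0 in probability,
   uniformly over the elementary predictable phi with |phi| <= 1.  The event is
   covered by a measurable A, as it is an uncountable union over t. *)
Definition emery_cvg (X_ : nat -> process) (X : process) : Prop :=
  forall eps : R, 0 < eps -> \forall n \near \oo,
    forall e : seq elem_term,
      (forall t w, `|elem_process e t w| <= 1) ->
      exists A : set Omega,
        [/\ measurable A, (P A <= eps%:E)%E
          & forall t w, 0 <= t <= T ->
              eps < `| X_ n 0 w - X 0 w
                       + elem_integral e (fun s v => X_ n s v - X s v) t w | ->
              A w].

Variables (d : nat) (S : 'I_d -> process).

(* [stoch_int H Z] means that the R^d-valued H is S-integrable (vector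
   stochastic integration) and that Z is a version of H . S.  It is the least
   relation which contains the elementary integrals and is closed under
   simultaneous pointwise convergence of integrands and Emery convergence of
   integrals:
   - by the monotone class theorem and dominated convergence it contains every
     bounded predictable H, hence every S-integrable H, for which
     (H 1_{|H| <= n}) . S converges to H . S;
   - conversely (Memin), if H_n . S converges to Z in Emery's topology and H_n
     converges pointwise to H, then H is S-integrable and Z = H . S.
   Every integral has a version whose paths are all cadlag and which is
   F_T-measurable; such a version is adapted up to null sets only, because the
   filtration need not be complete. *)
Inductive stoch_int : ('I_d -> process) -> process -> Prop :=
| stoch_int_elem (e : 'I_d -> seq elem_term) :
    stoch_int (fun j => elem_process (e j))
              (fun t w => \sum_(j < d) elem_integral (e j) (S j) t w)
| stoch_int_lim (H_ : nat -> 'I_d -> process) (Z_ : nat -> process)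
    (H : 'I_d -> process) (Z : process) :
    (forall n, stoch_int (H_ n) (Z_ n)) ->
    (forall j t w, 0 < t <= T -> H_ n j t w @[n --> \oo] --> H j t w) ->
    cadlag_paths Z ->
    (forall t, 0 <= t <= T -> measurable_fun setT (Z t)) ->
    emery_cvg Z_ Z ->
    stoch_int H Z.

(* H is in L(S) and Z is a version of H . S *)
Definition integral_of (H : 'I_d -> process) (Z : process) : Prop :=
  (forall j, predictable (H j)) /\ stoch_int H Z.

Variable U : R -> \bar R.

(* H is tame, Z being a version of H . S.  The real infimum is meaningful
   because cadlag paths are bounded on [0, T]. *)
Definition tame (H : 'I_d -> process) (Z : process) : Prop :=
  integral_of H Z /\
  orlicz P (Uhat U) (fun w => inf [set Z t w | t in `[0, T]]).

Definition terminal_wealths : set (Omega -> R) :=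
  [set X : Omega -> R | exists H Z, tame H Z /\ X = Z T].

Definition attainable : set (Omega -> R) :=
  [set X : Omega -> R | orlicz P (Uhat U) X /\
    exists K N, [/\ terminal_wealths K, L0_plus P N & X = K \- N]].

End StochasticIntegral.

Definition is_min {R : realType} (E : set (\bar R)) (m : \bar R) : Prop :=
  E m /\ lbound E m.

(* Main.v *)
(* Idea.  The sets [norm_closure] and [weak_closure] are handled by two
   inequalities: if [l X0] has finite expected utility for some [l > 1], then
   [X0] absorbs small perturbations, and for [Z] in [A] close to [X] in norm
     (1 - a) Z + a X0 = (1 - a) X + (a / l) (l X0) + a (1 - 1 / l) W
   with [W] in the unit ball, so concavity gives [I_U(X) <= sup_A I_U] when
   [a -> 0]; Fenchel's inequality [U(X) <= V(Y) + X Y] bounds [I_U] on the weak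
   closure by the dual value.

   For the existence of a dual minimizer, the value function
   [W |-> sup_(X in A) I_U(X + W)] on bounded random variables is finite near 0,
   and by Hahn-Banach it has there a supergradient [z], a positive functional on
   bounded random variables.  Its restriction to events is a finitely additive
   set function, whose largest minorant among measures has a density [Y].  The
   purely finitely additive rest is arbitrarily small on suitable sets of
   probability close to 1.  For [X] in [A] with [I_U(X) > -oo] the integral of
   [V(Y) + X Y = sup_q U(X + q) - q Y] is reached by simple random variables
   supported on such sets, so the rest can be dropped:
   [I_V(Y) + E[X Y] <= sup_A I_U].  This is the only place where [A] has to be
   intersected with the domain of [I_U]. *)
Require Import Defs.
From HB Require Import structures.
From mathcomp Require Import all_boot all_order all_algebra.
From mathcomp Require Import all_classical all_reals all_analysis.
From mathcomp Require Import measurable_realfun.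
From mathcomp Require Import ring lra.

Set Implicit Arguments.
Unset Strict Implicit.
Unset Printing Implicit Defensive.

Import Order.TTheory GRing.Theory Num.Theory.
Import numFieldNormedType.Exports.

Local Open Scope classical_set_scope.
Local Open Scope ring_scope.

(** * The Hahn-Banach theorem *)

Section HahnBanach.
Context {R : realType} {V : lmodType R}.
Variable D : set V.
Hypothesis DD : forall x y, D x -> D y -> D (x + y).
Hypothesis DZ : forall c x, D x -> D (c *: x).
Implicit Types x y : V.

(** Homogeneity is asked as an inequality for [c > 0]; applying it to the inverse of [c] turns it
    into an equality. Nothing is said of [q] outside the subspace [D]. *)
Definition sublinear_on (q : V -> R) : Prop :=
  (forall x y, D x -> D y -> q (x + y) <= q x + q y) /\
  (forall c x, 0 < c -> D x -> q (c *: x) <= c * q x).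

Let DN x : D x -> D (- x).
Proof. by move=> Dx; rewrite -scaleN1r; exact: DZ. Qed.

Let D0 x : D x -> D 0.
Proof. by move=> Dx; rewrite -(scale0r x); exact: DZ. Qed.

Lemma sublinear_on0 q x : D x -> sublinear_on q -> q 0 = 0.
Proof.
move=> /D0 d0 [_ qZ]; have h2 := qZ 2 0 ltac:(lra) d0.
have hh := qZ 2^-1 0 ltac:(lra) d0.
rewrite !scaler0 in h2 hh; lra.
Qed.

Lemma sublinear_on_ge q x y : sublinear_on q -> D x -> D y ->
  q y - q (- x) <= q (x + y).
Proof.
move=> [qD _] Dx Dy; have := qD _ _ (DN Dx) (DD Dx Dy).
by rewrite addKr; lra.
Qed.

(** Zorn's lemma: a chain of sublinear functionals below [p] has its pointwise infimum as a lower
    bound; on [D] the infimum is over a set bounded below, every member being at least [- p (- x)]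
    at [x]. *)
Lemma minimal_sublinear_on p : sublinear_on p -> exists q,
  [/\ sublinear_on q, forall x, D x -> q x <= p x &
   forall q', sublinear_on q' -> (forall x, D x -> q' x <= q x) ->
     forall x, D x -> q x <= q' x].
Proof.
move=> sp; pose Q := {q | sublinear_on q /\ forall x, D x -> q x <= p x}.
(* The order is reversed, so that a maximal element is a minimal functional. *)
pose le := fun q1 q2 : Q => `[< forall x, D x -> sval q2 x <= sval q1 x >].
have q0 : Q by exists p.
case: (@ZL_preorder Q q0 le).
- by move=> q; apply/asboolP.
- move=> q1 q2 q3 /asboolP h12 /asboolP h23; apply/asboolP => x Dx.
  exact: le_trans (h23 _ Dx) (h12 _ Dx).
- move=> A totA; have [A0|/set0P[q1 Aq1]] := eqVneq A set0.
    by exists q0 => s; rewrite A0.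
  have lb x : D x -> lbound [set sval q x | q in A] (- p (- x)).
    move=> Dx _ [q Aq <-]; have [sq qp] := proj2_sig q.
    have := sublinear_on_ge sq Dx (D0 Dx).
    rewrite (sublinear_on0 Dx sq) addr0 => h.
    have := qp _ (DN Dx); rewrite -/(sval q) in h *; lra.
  have hlb x : D x -> has_lbound [set sval q x | q in A].
    by move=> Dx; exists (- p (- x)); exact: lb.
  pose i x := inf [set sval q x | q in A].
  have ile (q : Q) x : A q -> D x -> i x <= sval q x.
    by move=> Aq Dx; apply: ge_inf; [exact: hlb|exists q].
  have lei x r : (forall q, A q -> r <= sval q x) -> r <= i x.
    by move=> h; apply: lb_le_inf => [|_ [q Aq <-]]; [exists (sval q1 x), q1|exact: h].
  have si : sublinear_on i.
    split=> [x y Dx Dy|c x c0 Dx].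
      rewrite -lerBlDr; apply: (lei _ _) => q Aq.
      rewrite lerBlDr -lerBlDl; apply: (lei _ _) => q' Aq'.
      rewrite lerBlDl.
      have Dxy := DD Dx Dy.
      (* Two members of the chain are comparable, and the smaller one can be used at both points. *)
      have [/asboolP h|/asboolP h] := totA _ _ Aq Aq'.
        have [[qD _] _] := proj2_sig q'; have := qD _ _ Dx Dy; rewrite -/(sval q').
        have := h _ Dx; have := ile _ _ Aq' Dxy; lra.
      have [[qD _] _] := proj2_sig q; have := qD _ _ Dx Dy; rewrite -/(sval q).
      have := h _ Dy; have := ile _ _ Aq Dxy; lra.
    rewrite mulrC -ler_pdivrMr//; apply: (lei _ _) => q Aq.
    rewrite ler_pdivrMr// mulrC.
    have [[_ qZ] _] := proj2_sig q; rewrite -/(sval q) in qZ.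
    by apply: le_trans (ile _ _ Aq (DZ c Dx)) _; exact: qZ.
  have ip x : D x -> i x <= p x.
    move=> Dx; apply: le_trans (ile _ _ Aq1 Dx) _.
    by have [_] := proj2_sig q1; apply.
  exists (exist _ i (conj si ip)) => q Aq; apply/asboolP => x Dx /=; exact: ile.
- move=> [q [sq qp]] qmin; exists q; split=> // q' sq' q'q x Dx.
  have q'p y : D y -> q' y <= p y by move=> Dy; exact: le_trans (q'q _ Dy) (qp _ Dy).
  have /asboolP := qmin (exist _ q' (conj sq' q'p)) ltac:(exact/asboolP).
  exact.
Qed.

(* A minimal sublinear functional is additive: it is not larger than
   x |-> inf_(t >= 0) (q (x + t y) - t q y), which is sublinear. *)
Theorem hahn_banach p : sublinear_on p -> exists f : V -> R,
  [/\ forall x y, D x -> D y -> f (x + y) = f x + f y,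
      forall c x, D x -> f (c *: x) = c * f x &
      forall x, D x -> f x <= p x].
Proof.
move=> /minimal_sublinear_on [q [sq qp qmin]].
have [qD qZ] := sq.
have qZge c x : 0 <= c -> D x -> q (c *: x) = c * q x.
  rewrite le_eqVlt => /predU1P[<- Dx|c0 Dx].
    by rewrite scale0r mul0r (sublinear_on0 Dx).
  apply/eqP; rewrite eq_le qZ//= -ler_pdivlMl//.
  have := qZ c^-1 (c *: x) ltac:(by rewrite invr_gt0) (DZ c Dx).
  by rewrite scalerA mulVf ?gt_eqF// scale1r.
have qadd x y : D x -> D y -> q (x + y) = q x + q y.
  move=> Dx Dy; apply/eqP; rewrite eq_le qD//=.
  pose q' x := inf [set q (x + t *: y) - t * q y | t in [set t | 0 <= t]].
  have ne z : [set q (z + t *: y) - t * q y | t in [set t | 0 <= t]] !=set0.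
    by exists (q (z + 0 *: y) - 0 * q y), 0 => //=.
  have lb z : D z -> lbound [set q (z + t *: y) - t * q y | t in [set t | 0 <= t]]
      (- q (- z)).
    move=> Dz _ [t /= t0 <-]; have := sublinear_on_ge sq Dz (DZ t Dy).
    by rewrite qZge//; lra.
  have q'le z t : D z -> 0 <= t -> q' z <= q (z + t *: y) - t * q y.
    move=> Dz t0; apply: ge_inf; first by exists (- q (- z)); exact: lb.
    by exists t.
  have leq' z r : (forall t, 0 <= t -> r <= q (z + t *: y) - t * q y) -> r <= q' z.
    by move=> h; apply: lb_le_inf => // _ [t /= t0 <-]; exact: h.
  have sq' : sublinear_on q'.
    split=> [z1 z2 D1 D2|c z c0 Dz].
      rewrite -lerBlDr; apply: (leq' _ _) => t t0.
      rewrite lerBlDr -lerBlDl; apply: (leq' _ _) => t' t'0.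
      rewrite lerBlDl.
      apply: le_trans (q'le _ (t + t') (DD D1 D2) (addr_ge0 t0 t'0)) _.
      have := qD _ _ (DD D1 (DZ t Dy)) (DD D2 (DZ t' Dy)).
      by rewrite addrACA -scalerDl; lra.
    rewrite mulrC -ler_pdivrMr//; apply: (leq' _ _) => t t0.
    rewrite ler_pdivrMr//.
    apply: le_trans (q'le _ (c * t) (DZ c Dz) (mulr_ge0 (ltW c0) t0)) _.
    rewrite -scalerA -scalerDr qZge ?(ltW c0)//; last exact: DD (DZ t Dy).
    by lra.
  have q'q z : D z -> q' z <= q z.
    move=> Dz; have := q'le z 0 Dz (lexx _).
    by rewrite scale0r addr0 mul0r subr0.
  (* Minimality gives [q x <= q' x], and [t = 1] in the infimum gives [q' x <= q (x + y) - q y]. *)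
  have := qmin _ sq' q'q x Dx; have := q'le x 1 Dx ler01.
  by rewrite scale1r mul1r; lra.
exists q; split => // c x Dx.
have [c0|c0] := leP 0 c; first exact: qZge.
have := qadd _ _ (DZ c Dx) (DZ (- c) Dx).
rewrite -scalerDl subrr scale0r (sublinear_on0 Dx sq) (@qZge (- c))//; last lra.
by lra.
Qed.

End HahnBanach.

(** * Finitely additive set functions *)

Section FinitelyAdditive.
Context {R : realType} {d : measure_display} {T : measurableType d}.
Variables (P : probability T R) (m : set T -> R).
Hypothesis m_ge0 : forall A, measurable A -> 0 <= m A.
Hypothesis m_add : forall A B, measurable A -> measurable B ->
  A `&` B = set0 -> m (A `|` B) = m A + m B.
Hypothesis m_null : forall A, measurable A -> P A = 0%E -> m A = 0.

Let m0 : m set0 = 0. Proof. exact: m_null. Qed.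

Let m_subadd A B : measurable A -> measurable B -> m (A `|` B) <= m A + m B.
Proof.
move=> mA mB; have mBA := measurableD mB mA.
have -> : A `|` B = A `|` B `\` A by rewrite setUDr setDv setD0.
rewrite m_add//; last by rewrite setDE setICA setICr setI0.
rewrite lerD2l -[in leRHS](setUIDK B A) m_add//; last 2 first.
- exact: measurableI.
- by rewrite setDE setIACA setICr setI0.
by rewrite lerDr; apply/m_ge0/measurableI.
Qed.

(** [m] may be negative on non-measurable sets, while the outer measure construction wants a set
    function that is nonnegative on all sets. *)
Let me (A : set T) : \bar R := (Num.max 0 (m A))%:E.

Let meE A : measurable A -> me A = (m A)%:E.
Proof. by move=> /m_ge0 h; rewrite /me max_r. Qed.

Let me0 : me set0 = 0%E.
Proof. by rewrite meE// m0. Qed.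

Let me_ge0 A : (0 <= me A)%E.
Proof. by rewrite lee_fin le_max lexx. Qed.

(* By finite additivity, the covers may be taken to be partitions: on measurable
   sets this is the largest measure below [m]. *)
Let reg : set T -> \bar R := mu_ext me.

HB.instance Definition _ := isOuterMeasure.Build R T reg
  (mu_ext0 me0 me_ge0) (mu_ext_ge0 me_ge0) (le_mu_ext me)
  (mu_ext_sigma_subadditive me_ge0).

Let reg_le A : measurable A -> (reg A <= (m A)%:E)%E.
Proof.
move=> mA; rewrite -(meE mA); apply: ereal_inf_lbound.
exists (fun n => if n is 0%N then A else set0).
  by split=> [[]// |t At]; exists 0%N.
apply/cvg_lim => //; rewrite -cvg_shiftS.
rewrite (_ : [sequence _]_n = cst (me A)); first exact: cvg_cst.
by rewrite funeqE => n /=; rewrite big_nat_recl//= big1 ?adde0// => i _; rewrite me0.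
Qed.

(** Intersecting each member of a cover with [A] and with its complement gives covers of both pieces
    with the same total, by finite additivity of [m]. *)
Let reg_caratheodory A : measurable A -> reg.-caratheodory A.
Proof.
move=> mA; apply: le_caratheodory_measurable => X.
apply: le_ereal_inf_tmp => _ [F [mF XF] <-].
have -> : (\sum_(k <oo) me (F k) =
    \sum_(k <oo) me (F k `&` A) + \sum_(k <oo) me (F k `&` ~` A))%E.
  rewrite -nneseriesD//; apply: eq_eseriesr => k _.
  have m1 := measurableI _ _ (mF k) mA.
  have m2 := measurableI _ _ (mF k) (measurableC mA).
  rewrite !meE// -EFinD -m_add//; first by rewrite -setIUr setUv setIT.
  by rewrite setIACA setICr setI0.
apply: leeD; apply: ereal_inf_lbound.
  exists (fun k => F k `&` A) => //; split=> [k|t [Xt At]]; first exact: measurableI.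
  by have [k _ Fk] := XF t Xt; exists k.
exists (fun k => F k `&` ~` A) => //; split=> [k|t [Xt At]].
  by apply: measurableI => //; exact: measurableC.
by have [k _ Fk] := XF t Xt; exists k.
Qed.

(** The Caratheodory inequality for the disjoint sets [F k], tested on their union, gives one half;
    countable subadditivity of the outer measure gives the other. *)
Let reg_additive : semi_sigma_additive reg.
Proof.
move=> F mF tF mUF.
have /= h := @caratheodory_lime_le _ _ reg F (fun n => reg_caratheodory (mF n)) tF
  (\bigcup_k F k).
have -> : reg (\bigcup_k F k) = (\sum_(k <oo) reg (F k))%E.
  apply/eqP; rewrite eq_le outer_measure_sigma_subadditive/=.
  move: h; rewrite setICr (outer_measure0 reg) adde0; apply: le_trans.
  apply: lee_nneseries => [k _ _|k _]; first exact: outer_measure_ge0.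
  by apply: le_outer_measure => t Ft; split=> //; exists k.
by apply: is_cvg_nneseries => k _ _; exact: outer_measure_ge0.
Qed.

HB.instance Definition _ := isMeasure.Build _ _ _ reg (outer_measure0 reg)
  (outer_measure_ge0 reg) reg_additive.

Let reg_fin : fin_num_fun reg.
Proof.
move=> A mA; rewrite ge0_fin_numE ?outer_measure_ge0//.
exact: le_lt_trans (reg_le mA) (ltry _).
Qed.

HB.instance Definition _ := Measure_isFinite.Build _ _ _ reg reg_fin.

Let reg_dominates : reg `<< P.
Proof.
apply/null_content_dominatesP => A mA PA.
apply/eqP; rewrite eq_le outer_measure_ge0 andbT.
by apply: le_trans (reg_le mA) _; rewrite m_null.
Qed.

(* Yosida-Hewitt: [m] is the sum of the measure of density [Y] and of a purely
   finitely additive set function, which is small on large sets. *)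
Lemma finitely_additive_density : exists Y : T -> R,
  [/\ measurable_fun setT Y, forall w, 0 <= Y w,
      P.-integrable setT (EFin \o Y),
      forall A, measurable A -> (\int[P]_(w in A) (Y w)%:E <= (m A)%:E)%E
    & forall eps, 0 < eps -> exists E : nat -> set T,
        [/\ forall n, measurable (E n), nondecreasing_seq E,
            \bigcup_n E n = setT
          & forall n, ((m (E n))%:E <= \int[P]_(w in E n) (Y w)%:E + eps%:E)%E]].
Proof.
have [f [f0 ffin fi fE]] := @radon_nikodym_sigma_finite _ _ _ P reg reg_dominates.
have Ef : EFin \o (fine \o f) = f.
  by apply/funext => w /=; rewrite fineK.
have iE A : measurable A -> (\int[P]_(w in A) (fine (f w))%:E = reg A)%E.
  by move=> mA; rewrite fE//; apply: eq_integral => w _; rewrite fineK.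
exists (fine \o f); split.
- by have /measurable_int mf := fi; exact: measurableT_comp.
- by move=> w /=; exact: fine_ge0.
- by rewrite Ef.
- by move=> A mA; rewrite iE//; exact: reg_le.
move=> eps e0.
(* [F] is a cover of the whole space, optimal up to [eps]; [E n] is the union of its first [n]
   members. *)
have [x [F [mF TF] <-] sF] := lb_ereal_inf_adherent e0 (reg_fin measurableT).
pose E n := \big[setU/set0]_(k < n) F k.
have mE n : measurable (E n) by apply: bigsetU_measurable.
exists E; split=> //.
- by move=> i j ij; apply/subsetPset; exact: subset_bigsetU.
- apply/seteqP; split=> // t _; have [k _ Fk] := TF t I.
  by exists k.+1 => //; rewrite /E big_ord_recr; right.
move=> n; rewrite iE//.
have mle k : (me (\big[setU/set0]_(i < k) F i) <= \sum_(0 <= i < k) me (F i))%E.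
  elim: k => [|k ih]; first by rewrite big_ord0 me0 big_nil.
  rewrite big_ord_recr big_nat_recr//=; apply: le_trans (leeD2r _ ih).
  have mk : measurable (\big[setU/set0]_(i < k) F i) by apply: bigsetU_measurable.
  rewrite !meE//; last exact: measurableU.
  by rewrite -EFinD lee_fin m_subadd.
rewrite -meE//.
(* The first [n] members bound [m (E n)] and the tail bounds [reg] of the complement, so the excess
   of the cover over [reg setT] bounds [m (E n) - reg (E n)]. *)
have : (me (E n) + reg (~` E n) <= reg setT + eps%:E)%E.
  apply: le_trans (ltW sF); rewrite (nneseries_split 0 n); last by move=> k _.
  rewrite add0n; apply: leeD; first exact: mle.
  apply: (@le_trans _ _ (\sum_(n <= k <oo) reg (F k))%E); last first.
    apply: lee_nneseries => [k _ _|k _]; first exact: outer_measure_ge0.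
    by rewrite meE//; exact: reg_le.
  apply: le_trans (outer_measure_sigma_subadditive_tail _ n F).
  apply: le_outer_measure => t /= nE; have [k _ Fk] := TF t I.
  exists k => //= kn; apply: nE; rewrite /E -bigcup_mkord; by exists k.
have mEn := measurableC (mE n).
rewrite -(setUv (E n)) measureU ?setICr// => h.
rewrite addeAC leeD2rE// in h.
exact: reg_fin.
Qed.

End FinitelyAdditive.

(** * Utility functions and their conjugates *)

Section UtilityFacts.
Context {R : realType} (U : R -> \bar R) (hU : utility U).
Local Open Scope ereal_scope.

Lemma utility_nonpos x : (x <= 0)%R -> U x <= 0.
Proof. by move=> x0; rewrite -(ut_at0 hU); exact: ut_nondecreasing. Qed.

Lemma utility_nonneg x : (0 <= x)%R -> 0 <= U x.
Proof. by move=> x0; rewrite -(ut_at0 hU); exact: ut_nondecreasing. Qed.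

Lemma utility_real x : -oo < U x -> U x = (fine (U x))%:E.
Proof. by move=> h; rewrite fineK// fin_real// h ut_lty. Qed.

Lemma utility_concave_real (x y t r s : R) : (0 <= t <= 1)%R ->
  U x = r%:E -> U y = s%:E ->
  (t * r + (1 - t) * s)%:E <= U (t * x + (1 - t) * y)%R.
Proof. by move=> t01 xr ys; have := ut_concave hU x y t01; rewrite xr ys. Qed.

Lemma utility_neg_dom : exists2 e : R, (0 < e)%R & -oo < U (- e)%R.
Proof.
have /ereal_inf_lt[_ [x Ux <-]] := ut_dom_inf hU.
by rewrite lte_fin => x0; exists (- x)%R; rewrite ?oppr_gt0 ?opprK.
Qed.

(** The chord over [[- e, 0]], continued to the right of 0, stays above a concave function: 0 is the
    convex combination of [- e] and [y] with weights [y / (y + e)] and [e / (y + e)]. *)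
Lemma utility_slope (e r y : R) : (0 < e)%R -> U (- e)%R = r%:E -> (0 <= y)%R ->
  U y <= (- r / e * y)%:E.
Proof.
move=> e0 Ue y0; have Uy : U y = (fine (U y))%:E.
  by apply: utility_real; exact: lt_le_trans (utility_nonneg y0).
move: Uy; move: (fine _) => s Uy.
have ye : (0 < y + e)%R by lra.
have t01 : (0 <= y / (y + e) <= 1)%R.
  by rewrite divr_ge0//= ?(ltW ye)// ler_pdivrMr// mul1r; lra.
have := utility_concave_real t01 Ue Uy.
have -> : (y / (y + e) * - e + (1 - y / (y + e)) * y)%R = 0%R.
  by field; rewrite gt_eqF.
rewrite Uy (ut_at0 hU) !lee_fin.
have -> : (y / (y + e) * r + (1 - y / (y + e)) * s =
  (y * r + e * s) / (y + e))%R by field; rewrite gt_eqF.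
rewrite ler_pdivrMr// mul0r => h.
by rewrite mulrAC ler_pdivlMr//; lra.
Qed.

(** With this bound the positive part of [U (X w)] is integrable as soon as [X] is. *)
Lemma utility_linear_bound : exists2 a : R, (0 <= a)%R & forall x, U x <= (a * `|x|)%:E.
Proof.
have [e e0 Ue] := utility_neg_dom.
have {}Ue := utility_real Ue; set r := fine _ in Ue.
have r0 : (r <= 0)%R by rewrite -lee_fin -Ue utility_nonpos// oppr_le0 ltW.
have a0 : (0 <= - r / e)%R by rewrite divr_ge0 ?oppr_ge0// (ltW e0).
exists (- r / e)%R => // x; have [x0|x0] := leP 0%R x.
  by rewrite ger0_norm//; exact: utility_slope.
by apply: le_trans (utility_nonpos (ltW x0)) _; rewrite lee_fin mulr_ge0.
Qed.

(** If [U (- 1) = 0], the slope bound makes [U] vanish on the positive half-line, so [U] already has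
    its limit value at 0, against the positivity of the saturation point. *)
Lemma utility_N1_lt0 : U (- 1)%R < 0.
Proof.
rewrite ltNge; apply/negP => U1.
have {}U1 : U (- 1)%R = 0.
  by apply/eqP; rewrite eq_le U1 utility_nonpos// lerN10.
have Upos y : (0 <= y)%R -> U y = 0.
  move=> y0; apply/eqP; rewrite eq_le utility_nonneg// andbT.
  by have := utility_slope ltr01 U1 y0; rewrite oppr0 !mul0r.
have Voo : value_at_infinity U = 0.
  apply/cvg_lim => //; apply: cvg_near_cst.
  by near=> x; apply: Upos; near: x; exact: nbhs_pinfty_ge.
have := ut_sat_inf hU; rewrite ltNge => /negP; apply.
by apply: ereal_inf_lbound; exists 0%R => //=; rewrite Upos// Voo.
Unshelve. all: by end_near. Qed.

Lemma Uhat_ge0 x : 0 <= Uhat U x.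
Proof. by rewrite oppe_ge0; apply: utility_nonpos; rewrite oppr_le0. Qed.

Lemma Uhat_le x y : (`|x| <= `|y|)%R -> Uhat U x <= Uhat U y.
Proof. by move=> xy; rewrite leeN2; apply: ut_nondecreasing; rewrite ?lerN2. Qed.

Lemma Uhat_norm x : Uhat U `|x|%R = Uhat U x.
Proof. by rewrite /Uhat normr_id. Qed.

Lemma Uhat0 : Uhat U 0%R = 0.
Proof. by rewrite /Uhat normr0 oppr0 (ut_at0 hU) oppe0. Qed.

(** By convexity [Uhat U] grows at least linearly beyond 1, so the Orlicz space is contained in L1.
    The constant is [Uhat U 1], or 1 if that is infinite. *)
Lemma Uhat_linear_bound : exists2 b : R, (0 < b)%R &
  forall x, (b * `|x|)%:E <= b%:E + Uhat U x.
Proof.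
have [b b0 Ub] : exists2 b : R, (0 < b)%R & U (- 1)%R <= (- b)%:E.
  have := utility_N1_lt0; case: (U (- 1)%R) => [r||]//.
    by rewrite lte_fin => r0; exists (- r)%R; rewrite ?oppr_gt0 ?opprK.
  by exists 1%R => //; rewrite leNye.
exists b => // x; have [x1|x1] := leP `|x|%R 1%R.
  by rewrite -[leLHS]adde0 leeD ?Uhat_ge0// lee_fin; nra.
rewrite -[leLHS]add0e leeD// ?lee_fin ?(ltW b0)//.
rewrite /Uhat leeNr.
have [Ux|] := eqVneq (U (- `|x|)%R) -oo; first by rewrite Ux leNye.
rewrite -ltNye => /utility_real Ux; set s := fine _ in Ux.
have x0 : (0 < `|x|)%R by lra.
have t01 : (0 <= `|x|^-1 <= 1)%R by rewrite invr_ge0 normr_ge0 invf_le1// ltW.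
have := utility_concave_real t01 Ux (ut_at0 hU).
rewrite !mulr0 !addr0 mulrN mulVf ?gt_eqF// => /le_trans/(_ Ub).
by rewrite Ux -EFinN !lee_fin ler_pdivrMl// mulrN mulrC.
Qed.

Lemma Uhat_convex (x y t : R) : (0 <= t <= 1)%R ->
  Uhat U (t * x + (1 - t) * y)%R <= t%:E * Uhat U x + (1 - t)%:E * Uhat U y.
Proof.
move=> /[dup] t01 /andP[t0 t1].
have := ut_concave hU (- `|x|)%R (- `|y|)%R t01.
rewrite -leeN2 => h; apply: le_trans (_ : - U (- (t * `|x| + (1 - t) * `|y|))%R <= _).
  rewrite leeN2; apply: ut_nondecreasing => //; rewrite lerN2.
  apply: le_trans (ler_normD _ _) _; rewrite !normrM (ger0_norm t0).
  by rewrite (ger0_norm (_ : (0 <= 1 - t)%R)) ?subr_ge0.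
have -> : (- (t * `|x| + (1 - t) * `|y|) = t * - `|x| + (1 - t) * - `|y|)%R by ring.
apply: le_trans h _; rewrite /Uhat !muleN -oppeD//.
apply: ltpinfty_adde_def; rewrite inE/=; apply: lte_mul_pinfty => //; rewrite ?lee_fin ?subr_ge0 ?ut_lty//.
Qed.

End UtilityFacts.

(** * Integral inequalities and measurability of the conjugates *)

Section Integrals.
Context {R : realType} {dsp : measure_display} {Omega : measurableType dsp}.
Variable P : probability Omega R.
Local Open Scope ereal_scope.

(** The integral is the difference of the integrals of the positive and negative parts, and the
    convention [oo - oo = -oo] keeps this difference monotone; infinite integrals are thus
    covered. *)
Lemma ae_le_integral_measurable (f g : Omega -> \bar R) :
  measurable_fun setT f -> measurable_fun setT g -> {ae P, forall w, f w <= g w} ->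
  \int[P]_w f w <= \int[P]_w g w.
Proof.
move=> mf mg fg; rewrite integralE [leRHS]integralE; apply: leeB.
  apply: ae_ge0_le_integral => //; [exact: measurable_funepos..|].
  apply: filterS fg => w fg _.
  by apply: (@funepos_le _ _ [set w]) => [v|]; rewrite ?inE//= => ->.
apply: ae_ge0_le_integral => //; [exact: measurable_funeneg..|].
apply: filterS fg => w fg _.
by apply: (@funeneg_le _ _ [set w]) => [v|]; rewrite ?inE//= => ->.
Qed.

Lemma le_integral_measurable (f g : Omega -> \bar R) :
  measurable_fun setT f -> measurable_fun setT g -> (forall w, f w <= g w) ->
  \int[P]_w f w <= \int[P]_w g w.
Proof. by move=> mf mg fg; apply: ae_le_integral_measurable => //; exact: aeW. Qed.

(** The index set of the supremum is uncountable, so the measurability of [conjV U] and [Vhat U] is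
    derived from semicontinuity. *)
Lemma lower_semicontinuous_sup_affine (f : R -> \bar R) :
  lower_semicontinuous (fun y : R => ereal_sup [set (x * y)%:E + f x | x in setT]).
Proof.
move=> y a /ereal_sup_gt[_ [x _ <-]].
case fx : (f x) => [r||] //= h.
- exists [set z | (a - r < x * z)%R].
    apply: (@open_nbhs_nbhs _ y); split=> /=; last first.
      by move: h; rewrite -EFinD lte_fin; lra.
    apply: (@open_comp _ _ ( *%R x) [set z | (a - r < z)%R]); last exact: open_gt.
    by move=> z _; exact: mulrl_continuous.
  move=> z /= hz; apply: lt_le_trans (ereal_sup_ubound _); last by exists x.
  by rewrite fx -EFinD lte_fin; lra.
- exists setT; first exact: filterT.
  move=> z _; apply: lt_le_trans (ereal_sup_ubound _); last by exists x.
  by rewrite fx addey// ltry.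
Qed.

Lemma measurable_conjV (U : R -> \bar R) : measurable_fun setT (conjV U).
Proof.
apply: lower_semicontinuous_measurable.
have -> : conjV U = fun y => ereal_sup [set (x * y)%:E + U (- x)%R | x in setT].
  apply/funext => y; congr ereal_sup; apply/seteqP; split=> _ [x _ <-].
    by exists (- x)%R => //; rewrite opprK mulNr EFinN addeC.
  by exists (- x)%R => //; rewrite mulNr EFinN oppeK addeC.
exact: lower_semicontinuous_sup_affine.
Qed.

Lemma measurable_Vhat (U : R -> \bar R) : measurable_fun setT (Vhat U).
Proof.
by apply: lower_semicontinuous_measurable; exact: lower_semicontinuous_sup_affine.
Qed.

Lemma Vhat_ge (U : R -> \bar R) (x y : R) : (x * y)%:E - Uhat U x <= Vhat U y.
Proof. by apply: ereal_sup_ubound; exists x. Qed.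

Lemma Vhat_norm (U : R -> \bar R) (y : R) : Vhat U `|y|%R = Vhat U y.
Proof.
have [y0|y0] := leP 0%R y; first by rewrite ger0_norm.
rewrite ltr0_norm//; congr ereal_sup; apply/seteqP; split=> _ [x _ <-];
  exists (- x)%R => //; rewrite ?mulrN ?mulNr ?opprK /Uhat ?normrN//.
Qed.

Lemma conjV_ge (U : R -> \bar R) (x y : R) : U x - (x * y)%:E <= conjV U y.
Proof. by apply: ereal_sup_ubound; exists x. Qed.

Variables (U : R -> \bar R) (hU : utility U).

Lemma Vhat_ge0 y : 0 <= Vhat U y.
Proof.
by apply: le_trans (Vhat_ge U 0%R y); rewrite mul0r Uhat0// sube0.
Qed.

Lemma conjV_ge0 y : 0 <= conjV U y.
Proof.
by apply: le_trans (conjV_ge U 0%R y); rewrite mul0r (ut_at0 hU) sube0.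
Qed.

Lemma young_Uhat (x y : R) : (`|x * y|)%:E <= Uhat U x + Vhat U y.
Proof.
rewrite -(Uhat_norm U x) -(Vhat_norm U y) normrM.
have := Vhat_ge U `|x|%R `|y|%R.
have := Uhat_ge0 hU `|x|%R; case: (Uhat U `|x|%R) => [r||]// _.
  by rewrite leeBlDl// fin_numE.
move=> _; rewrite addye ?leey//.
by rewrite gt_eqF// (lt_le_trans _ (Vhat_ge0 _))// ltNy0.
Qed.

Lemma measurable_utility : measurable_fun setT U.
Proof.
have -> : U = fun x => - - U x by apply/funext => x; rewrite oppeK.
by apply: measurableT_comp => //; exact: lower_semicontinuous_measurable (ut_usc hU).
Qed.

Lemma measurable_Uhat : measurable_fun setT (Uhat U).
Proof.
apply: measurableT_comp => //; apply: (measurableT_comp measurable_utility).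
by apply: measurableT_comp => //; exact: normr_measurable.
Qed.

End Integrals.

(** * Orlicz spaces *)

Section OrliczSpace.
Context {R : realType} {dsp : measure_display} {Omega : measurableType dsp}.
Variables (P : probability Omega R) (U : R -> \bar R).
Hypothesis hU : utility U.
Implicit Types X Y Z W : Omega -> R.

Let mUhat X : measurable_fun setT X -> measurable_fun setT (Uhat U \o X).
Proof. by move=> mX; apply: measurableT_comp => //; exact: measurable_Uhat. Qed.

Let mU X : measurable_fun setT X -> measurable_fun setT (U \o X).
Proof. by move=> mX; apply: measurableT_comp => //; exact: measurable_utility. Qed.

Let mZ (c : R) X : measurable_fun setT X -> measurable_fun setT (fun w => c * X w).
Proof. by move=> mX; apply: measurable_funM. Qed.

Lemma orlicz_le X Y : orlicz P (Uhat U) X -> measurable_fun setT Y ->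
  {ae P, forall w, `|Y w| <= `|X w|} -> orlicz P (Uhat U) Y.
Proof.
move=> [mX [l l0 h]] mY YX; split=> //; exists l => //.
apply: le_lt_trans h; apply: ae_ge0_le_integral => //.
- by move=> w _; exact: Uhat_ge0.
- by apply: mUhat; exact: mZ.
- by move=> w _; exact: Uhat_ge0.
- by apply: mUhat; exact: mZ.
apply: filterS YX => w YXw _; apply: Uhat_le => //.
by rewrite !normrM ler_wpM2l.
Qed.

Lemma If_Uhat_le X Y : measurable_fun setT X -> measurable_fun setT Y ->
  (forall w, `|Y w| <= `|X w|) -> (If P (Uhat U) Y <= If P (Uhat U) X)%E.
Proof.
move=> mX mY YX; apply: le_integral_measurable; [exact: mUhat..|].
by move=> w; exact: Uhat_le.
Qed.

Lemma orliczZ c X : orlicz P (Uhat U) X -> orlicz P (Uhat U) (fun w => c * X w).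
Proof.
move=> [mX [l l0 h]]; split; first exact: mZ.
have c1 : 0 < `|c| + 1 by rewrite ltr_wpDl.
exists (l / (`|c| + 1)); first exact: divr_gt0.
apply: le_lt_trans h; apply: If_Uhat_le; [exact: mZ|by do 2 apply: mZ|].
move=> w; rewrite mulrA !normrM ler_wpM2r// (gtr0_norm l0) normfV (gtr0_norm c1).
by rewrite -mulrA ler_piMr ?(ltW l0)// ler_pdivrMl// mulr1 lerDl.
Qed.

(** With [2 r] at most [l] and [k], [r (X + Y)] is the midpoint of [2 r X] and [2 r Y], to which
    convexity and monotonicity apply. *)
Lemma orliczD X Y : orlicz P (Uhat U) X -> orlicz P (Uhat U) Y ->
  orlicz P (Uhat U) (X \+ Y).
Proof.
move=> [mX [l l0 hX]] [mY [k k0 hY]]; split; first exact: measurable_funD.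
have [r [r0 rl rk]] : exists r : R, [/\ 0 < r, r * 2 <= l & r * 2 <= k].
  exists (Num.min l k / 2); rewrite divr_gt0 ?lt_min ?l0//.
  by split=> //; rewrite mulfVK// ge_min lexx ?orbT.
exists r => //.
apply: (@le_lt_trans _ _ (\int[P]_w (2^-1%:E * Uhat U (l * X w)%R +
    (1 - 2^-1)%:E * Uhat U (k * Y w)%R))%E).
  apply: le_integral_measurable => [||w].
  - by apply: mUhat; apply: mZ; exact: measurable_funD.
  - by apply: emeasurable_funD; apply: emeasurable_funM => //; apply: mUhat; exact: mZ.
  have -> : r * (X \+ Y) w = 2^-1 * (r * 2 * X w) + (1 - 2^-1) * (r * 2 * Y w).
    by rewrite /=; lra.
  have h : 0 <= (2^-1 : R) <= 1 by lra.
  apply: le_trans (Uhat_convex hU _ _ h) _; apply: leeD; apply: lee_wpmul2l => //.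
  - apply: Uhat_le => //; rewrite !normrM (gtr0_norm r0) (gtr0_norm l0).
    by rewrite (gtr0_norm (_ : 0 < 2))// ler_wpM2r.
  - by rewrite lee_fin; lra.
  - apply: Uhat_le => //; rewrite !normrM (gtr0_norm r0) (gtr0_norm k0).
    by rewrite (gtr0_norm (_ : 0 < 2))// ler_wpM2r.
have u0 x : (0 <= Uhat U x)%E by exact: Uhat_ge0.
rewrite ge0_integralD//; last 4 first.
- by move=> w _; rewrite mule_ge0// lee_fin; lra.
- by apply: emeasurable_funM => //; apply: mUhat; exact: mZ.
- by move=> w _; rewrite mule_ge0// lee_fin; lra.
- by apply: emeasurable_funM => //; apply: mUhat; exact: mZ.
rewrite !ge0_integralZl_EFin//; last 3 first.
- by apply: mUhat; exact: mZ.
- by lra.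
- by apply: mUhat; exact: mZ.
by apply: lte_add_pinfty; apply: lte_mul_pinfty => //; rewrite lee_fin; lra.
Qed.

Lemma orliczB X Y : orlicz P (Uhat U) X -> orlicz P (Uhat U) Y ->
  orlicz P (Uhat U) (X \- Y).
Proof.
move=> hX /(orliczZ (-1)) hY; have := orliczD hX hY.
by congr orlicz; apply/funext => w /=; rewrite mulN1r.
Qed.

Lemma orlicz_bounded W (M : R) : measurable_fun setT W -> (forall w, `|W w| <= M) ->
  orlicz P (Uhat U) W.
Proof.
move=> mW hM; split=> //; have [e e0 Ue] := utility_neg_dom hU.
have M1 : 0 < `|M| + 1 by rewrite ltr_wpDl.
(* The factor brings [W] into [[- e, e]], where [Uhat U] is at most the finite [Uhat U e]; the [+ 1]
   covers [M = 0]. *)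
exists (e / (`|M| + 1)); first exact: divr_gt0.
apply: (@le_lt_trans _ _ (\int[P]_w (Uhat U e))%E).
  apply: le_integral_measurable => [||w] //.
    by apply: mUhat; exact: mZ.
  apply: Uhat_le => //; rewrite normrM normrM normfV !(gtr0_norm M1).
  rewrite -mulrA ler_piMr// ler_pdivrMl// mulr1.
  by apply: le_trans (hM w) _; apply: le_trans (ler_norm _) _; rewrite lerDl.
rewrite integral_cst//= probability_setT mule1 /Uhat (gtr0_norm e0).
by rewrite lteNl.
Qed.

Lemma orlicz_integrable X : orlicz P (Uhat U) X -> P.-integrable setT (EFin \o X).
Proof.
move=> [mX [l l0 h]]; have [b b0 hb] := Uhat_linear_bound hU.
have iU : P.-integrable setT (fun w => Uhat U (l * X w)).
  apply/integrableP; split; first by apply: mUhat; exact: mZ.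
  by under eq_integral do rewrite gee0_abs ?Uhat_ge0//.
apply: (@le_integrable _ _ _ P _ measurableT _
    (fun w => (l * b)^-1%:E * (b%:E + Uhat U (l * X w)))%E) => //.
- exact/measurable_EFinP.
- move=> w _ /=; rewrite [leRHS]gee0_abs; last first.
    rewrite mule_ge0 ?adde_ge0 ?Uhat_ge0 ?lee_fin ?(ltW b0)//.
    by rewrite invr_ge0 mulr_ge0 ?(ltW b0) ?(ltW l0).
  rewrite lee_pdivlMl ?mulr_gt0// -EFinM.
  by apply: le_trans (hb _); rewrite normrM (gtr0_norm l0) lee_fin mulrCA mulrA.
apply: integrableZl => //; apply: integrableD => //.
exact: finite_measure_integrable_cst.
Qed.

Lemma utility_comp_upper X : orlicz P (Uhat U) X -> exists2 a : R, 0 <= a &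
  P.-integrable setT (fun w => (a * `|X w|)%:E) /\
  forall w, (U (X w) <= (a * `|X w|)%:E)%E.
Proof.
move=> oX; have [a a0 ha] := utility_linear_bound hU; exists a => //; split=> //.
under eq_fun do rewrite EFinM.
by apply: integrableZl => //; apply: (integrable_abse (orlicz_integrable oX)).
Qed.

Lemma If_utility_lty X : orlicz P (Uhat U) X -> (If P U X < +oo)%E.
Proof.
move=> oX; have [a a0 [ia ha]] := utility_comp_upper oX.
apply: (@le_lt_trans _ _ (\int[P]_w (a * `|X w|)%:E)%E).
  apply: le_integral_measurable => //; last exact: measurable_int ia.
  by apply: mU; case: oX.
by have := integrable_fin_num measurableT ia; rewrite fin_numElt => /andP[].
Qed.

(** The linear bound on [U] controls the positive part; an infinite negative part would make the
    expected utility [-oo]. *)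
Lemma utility_comp_integrable X : orlicz P (Uhat U) X -> (-oo < If P U X)%E ->
  P.-integrable setT (U \o X).
Proof.
move=> oX h; have mX : measurable_fun setT X by case: oX.
have [a a0 [ia ha]] := utility_comp_upper oX.
have p : (\int[P]_w ((U \o X)^\+ w) < +oo)%E.
  apply: (@le_lt_trans _ _ (\int[P]_w (a * `|X w|)%:E)%E).
    apply: le_integral_measurable; [exact/measurable_funepos/mU|exact: measurable_int ia|].
    by move=> w; rewrite funeposE ge_max ha lee_fin mulr_ge0.
  by have := integrable_fin_num measurableT ia; rewrite fin_numElt => /andP[].
have n : (\int[P]_w ((U \o X)^\- w) < +oo)%E.
  rewrite ltNge; apply/negP; rewrite leye_eq => /eqP n.
  by move: h; rewrite /If integralE -/(U \o X) n addeNy.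
apply/integrableP; split; first exact: mU.
have -> : (fun w => `|(U \o X) w|)%E = ((U \o X)^\+ \+ (U \o X)^\-)%E.
  exact: (fune_abse (U \o X)).
rewrite ge0_integralD//; first exact: lte_add_pinfty.
- exact/measurable_funepos/mU.
- exact/measurable_funeneg/mU.
Qed.

Lemma If_utility_fin X : orlicz P (Uhat U) X -> (-oo < If P U X)%E ->
  If P U X = (fine (If P U X))%:E.
Proof. by move=> oX h; rewrite fineK// fin_real// h If_utility_lty. Qed.

Lemma If_concave X Y (t : R) : 0 <= t <= 1 ->
  orlicz P (Uhat U) X -> orlicz P (Uhat U) Y ->
  (-oo < If P U X)%E -> (-oo < If P U Y)%E ->
  (t%:E * If P U X + (1 - t)%:E * If P U Y <=
   If P U (fun w => t * X w + (1 - t) * Y w)%R)%E.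
Proof.
move=> t01 oX oY hX hY.
have iX := utility_comp_integrable oX hX.
have iY := utility_comp_integrable oY hY.
have mX : measurable_fun setT X by case: oX.
have mY : measurable_fun setT Y by case: oY.
rewrite -!integralZl// -integralD//; [|exact: integrableZl..].
apply: le_integral_measurable.
- by apply: emeasurable_funD; apply: emeasurable_funM => //; apply: mU.
- by apply: mU; apply: measurable_funD; exact: mZ.
- by move=> w; exact: ut_concave.
Qed.

(* The infimum of an empty set of reals is 0 in Rocq, hence the need for
   [orlicz P (Uhat U) X]. *)
Lemma orlicz_norm_lt X (eps : R) : 0 < eps -> orlicz P (Uhat U) X ->
  orlicz_norm P (Uhat U) X < eps -> (If P (Uhat U) (fun w => (X w / eps)%R) <= 1)%E.
Proof.
move=> e0 [mX [l l0 h]].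
have fin : If P (Uhat U) (fun w => l * X w) \is a fin_num.
  by rewrite ge0_fin_numE//; apply: integral_ge0 => w _; exact: Uhat_ge0.
pose c := fine (If P (Uhat U) (fun w => l * X w)).
have c0 : 0 <= c by apply/fine_ge0/integral_ge0 => w _; exact: Uhat_ge0.
have c1 : 0 < c + 1 by rewrite ltr_wpDl.
rewrite /orlicz_norm => /inf_lt [].
  (* Convexity between [l X] and 0 with weight [1 / (c + 1)] bounds the integral by [c / (c + 1)],
     so the set defining the norm is not empty. *)
  exists ((c + 1) / l); split; first exact: divr_gt0.
  apply: (@le_trans _ _ (\int[P]_w ((c + 1)^-1%:E * Uhat U (l * X w)))%E).
    apply: le_integral_measurable => [||w].
    - by apply: mUhat; apply: measurable_funM.
    - by apply: emeasurable_funM => //; apply: mUhat; exact: mZ.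
    have t01 : 0 <= (c + 1)^-1 <= 1.
      by rewrite invr_ge0 (ltW c1)/= invf_le1// lerDr.
    have := Uhat_convex hU (l * X w) 0 t01.
    rewrite Uhat0// mule0 adde0 mulr0 addr0; congr (Uhat U _ <= _)%E.
    by rewrite invf_div [in RHS]mulrC mulrA; congr (_ * _); rewrite mulrC.
  rewrite ge0_integralZl_EFin//; last 3 first.
  - by move=> w _; exact: Uhat_ge0.
  - by apply: mUhat; exact: mZ.
  - by rewrite invr_ge0 ltW.
  rewrite -[X in (_ * X)%E]fineK// -/c -EFinM lee_fin ler_pdivrMl// mulr1.
  by rewrite lerDl.
move=> r [r0 hr] re; apply: le_trans hr; apply: If_Uhat_le.
- by apply: measurable_funM.
- by apply: measurable_funM.
move=> w; rewrite !normrM ler_wpM2l// !normfV (gtr0_norm r0) (gtr0_norm e0).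
by rewrite lef_pV2 ?posrE// ltW.
Qed.

Lemma orlicz_pairing X Y : orlicz P (Uhat U) X -> orlicz P (Vhat U) Y ->
  P.-integrable setT (EFin \o (X \* Y)).
Proof.
move=> [mX [l l0 hX]] [mY [k k0 hY]].
have mV : measurable_fun setT (fun w => Vhat U (k * Y w)).
  by apply: (measurableT_comp (measurable_Vhat U)); exact: mZ.
have iX : P.-integrable setT (fun w => Uhat U (l * X w)).
  apply/integrableP; split; first by apply: mUhat; exact: mZ.
  by under eq_integral do rewrite gee0_abs ?Uhat_ge0//.
have iY : P.-integrable setT (fun w => Vhat U (k * Y w)).
  apply/integrableP; split => //.
  by under eq_integral do rewrite gee0_abs ?Vhat_ge0//.
apply: (@le_integrable _ _ _ P _ measurableT _
    (fun w => (l * k)^-1%:E * (Uhat U (l * X w) + Vhat U (k * Y w)))%E) => //.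
- by apply/measurable_EFinP; exact: measurable_funM.
- move=> w _ /=; rewrite [leRHS]gee0_abs; last first.
    rewrite mule_ge0 ?adde_ge0 ?Uhat_ge0 ?Vhat_ge0 ?lee_fin//.
    by rewrite invr_ge0 mulr_ge0 ?(ltW k0) ?(ltW l0).
  rewrite lee_pdivlMl ?mulr_gt0// -EFinM.
  apply: le_trans (young_Uhat hU _ _); rewrite lee_fin -mulrACA [in leRHS]normrM.
  by rewrite (gtr0_norm (mulr_gt0 l0 k0)).
by apply: integrableZl => //; exact: integrableD.
Qed.

End OrliczSpace.

(** * Concavity of expected utility around a core point *)

Section ConvexSets.
Context {R : realType} {dsp : measure_display} {Omega : measurableType dsp}.
Variables (P : probability Omega R) (U : R -> \bar R).
Hypothesis hU : utility U.
Implicit Types X Y Z W : Omega -> R.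

Lemma If_ae_eq (f : R -> \bar R) X Y : measurable_fun setT f ->
  measurable_fun setT X -> measurable_fun setT Y ->
  {ae P, forall w, X w = Y w} -> If P f X = If P f Y.
Proof.
move=> mf mX mY XY; apply: ae_eq_integral => //; [exact: measurableT_comp..|].
by apply: filterS XY => w /= ->.
Qed.

Lemma If_utility_ge_Uhat W : measurable_fun setT W ->
  (- If P (Uhat U) W <= If P U W)%E.
Proof.
move=> mW; have mU := measurable_utility hU; have mH := measurable_Uhat hU.
rewrite /If -integral_ge0N; last by move=> w _; exact: Uhat_ge0.
apply: le_integral_measurable; [|exact: measurableT_comp|].
  by apply: measurableT_comp => //; exact: measurableT_comp.
move=> w; rewrite /Uhat oppeK; apply: ut_nondecreasing => //.
by rewrite lerNl -normrN ler_norm.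
Qed.

Lemma If_utility_bounded_below W (e : R) : measurable_fun setT W ->
  (-oo < U (- e))%E -> (forall w, `|W w| <= e) -> (-oo < If P U W)%E.
Proof.
move=> mW Ue We; apply: (@lt_le_trans _ _ (\int[P]_w U (- e)%R)%E).
  by rewrite integral_cst//= probability_setT mule1.
apply: le_integral_measurable => //.
  by apply: measurableT_comp => //; exact: measurable_utility.
move=> w; apply: ut_nondecreasing => //.
by have := We w; rewrite ler_norml => /andP[].
Qed.

Lemma If_utility0 : If P U (fun=> 0) = 0%E.
Proof. by rewrite /If integral_cst//= (ut_at0 hU) mul0e. Qed.

Lemma orlicz0 : orlicz P (Uhat U) (fun=> 0).
Proof. by apply: (@orlicz_bounded _ _ _ P _ hU _ 0) => // w; rewrite normr0. Qed.

Lemma If_concave_gtNy X Y (t : R) : 0 <= t <= 1 ->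
  orlicz P (Uhat U) X -> orlicz P (Uhat U) Y ->
  (-oo < If P U X)%E -> (-oo < If P U Y)%E ->
  (-oo < If P U (fun w => t * X w + (1 - t) * Y w)%R)%E.
Proof.
move=> t01 oX oY hX hY; apply: lt_le_trans (If_concave hU t01 oX oY hX hY).
by rewrite (If_utility_fin hU oX hX) (If_utility_fin hU oY hY) -!EFinM -EFinD ltNyr.
Qed.

Variables (X0 : Omega -> R) (l : R).
Hypothesis (l1 : 1 < l) (oX0 : orlicz P (Uhat U) X0).
Hypothesis (dX0 : (-oo < If P U (fun w => l * X0 w)%R)%E).

Let l0 : 0 < l. Proof. by rewrite (lt_trans _ l1). Qed.

Let t01 : 0 <= l^-1 <= 1. Proof. by rewrite invr_ge0 (ltW l0)/= invf_le1 ?(ltW l1). Qed.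

(** [X0 + (1 - 1/l) W] is a convex combination of [l X0] and [W]: this is the room that a core point
    leaves for perturbations. *)
Let cmb (W : Omega -> R) :
  (fun w => l^-1 * (l * X0 w) + (1 - l^-1) * W w) = (fun w => X0 w + (1 - l^-1) * W w).
Proof. by apply/funext => w; rewrite mulrA mulVf ?gt_eqF// mul1r. Qed.

Lemma core_perturbation W : orlicz P (Uhat U) W -> (-oo < If P U W)%E ->
  (-oo < If P U (fun w => X0 w + (1 - l^-1) * W w)%R)%E.
Proof.
move=> oW dW; rewrite -cmb; apply: If_concave_gtNy => //; exact: orliczZ.
Qed.

Lemma core_dom : (-oo < If P U X0)%E.
Proof.
have := core_perturbation orlicz0; rewrite If_utility0 => /(_ (ltNyr 0)).
by congr (_ < If P U _)%E; apply/funext => w; rewrite mulr0 addr0.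
Qed.

(** Concavity is used twice, first between [l X0] and [W], then with [X]; since [E[Uhat(W)] <= 1]
    gives [I_U(W) >= -1], the lower bound does not depend on [W]. *)
Lemma core_interpolation X W (a : R) : 0 <= a <= 1 ->
  orlicz P (Uhat U) X -> (-oo < If P U X)%E ->
  orlicz P (Uhat U) W -> (If P (Uhat U) W <= 1)%E ->
  (((1 - a) * fine (If P U X) +
     a * (l^-1 * fine (If P U (fun w => l * X0 w)) - (1 - l^-1)))%R%:E <=
   If P U (fun w => (1 - a) * X w + a * (X0 w + (1 - l^-1) * W w))%R)%E.
Proof.
move=> a01 oX dX oW W1.
have oX0l := orliczZ hU l oX0.
have UW : (- 1%:E <= If P U W)%E.
  by apply: le_trans (If_utility_ge_Uhat _); [rewrite leeN2|case: oW].
have dW : (-oo < If P U W)%E by apply: lt_le_trans UW; rewrite ltNyr.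
have := If_concave hU t01 oX0l oW dX0 dW.
rewrite cmb (If_utility_fin hU oX0l dX0) (If_utility_fin hU oW dW).
rewrite (If_utility_fin hU oW dW) -EFinN lee_fin in UW.
have dZ := core_perturbation oW dW.
have oZ : orlicz P (Uhat U) (fun w => X0 w + (1 - l^-1) * W w).
  by apply: orliczD => //; exact: orliczZ.
have b01 : 0 <= 1 - a <= 1 by lra.
have := If_concave hU b01 oX oZ dX dZ; rewrite subKr.
rewrite (If_utility_fin hU oX dX) (If_utility_fin hU oZ dZ) -!EFinM -!EFinD.
rewrite [fine _%:E]/= lee_fin => h1 h2; apply: le_trans h1; rewrite lee_fin lerD2l.
have /andP[_ tle] := t01; have /andP[a0 _] := a01.
apply: ler_wpM2l => //; apply: le_trans h2.
rewrite lerD2l; nra.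
Qed.

End ConvexSets.

(** * Closures and weak duality *)

(** The limit [t -> 0] made explicit: if [u < a], a small [t] with [t (a - b) <= (a - u) / 2] gives
    a contradiction. *)
Lemma segment_limit_le {R : realFieldType} (a b u : R) :
  (forall t, 0 < t < 1 -> (1 - t) * a + t * b <= u) -> a <= u.
Proof.
move=> h; rewrite leNgt; apply/negP => ua.
pose c := a - u + `|a - b|; have c0 : 0 < c by rewrite ltr_pwDl ?subr_gt0.
pose t := (a - u) / (2 * c).
have tc : t * c = (a - u) / 2 by rewrite /t; field; rewrite gt_eqF.
have t0 : 0 < t by rewrite divr_gt0 ?subr_gt0 ?mulr_gt0.
have t1 : t < 1.
  rewrite ltr_pdivrMr ?mulr_gt0// mul1r /c; have := normr_ge0 (a - b); lra.
have := h t ltac:(by rewrite t0).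
have : t * (a - b) <= t * c.
  by rewrite ler_wpM2l ?(ltW t0)// /c; have := ler_norm (a - b); lra.
by rewrite tc; lra.
Qed.

Section Duality.
Context {R : realType} {dsp : measure_display} {Omega : measurableType dsp}.
Variables (P : probability Omega R) (U : R -> \bar R).
Hypothesis hU : utility U.
Implicit Types X Y Z W : Omega -> R.
Variable A : set (Omega -> R).
Hypothesis A_orlicz : A `<=` orlicz P (Uhat U).
Hypothesis A_convex : forall X Y (t : R), 0 <= t <= 1 -> A X -> A Y ->
  A (fun w => (1 - t) * X w + t * Y w).
Variables (X0 : Omega -> R) (l : R).
Hypothesis (l1 : 1 < l) (AX0 : A X0).
Hypothesis (dX0 : (-oo < If P U (fun w => l * X0 w)%R)%E).

Let u := ereal_sup [set If P U X | X in A].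

Let G := A `&` domI P U.

Let l0 : 0 < l. Proof. by rewrite (lt_trans _ l1). Qed.

Let li1 : l^-1 < 1. Proof. by rewrite invf_lt1. Qed.

Let oX0 : orlicz P (Uhat U) X0. Proof. exact: A_orlicz. Qed.

Let GX0 : G X0.
Proof. by split=> //; split=> //; exact: core_dom l1 oX0 dX0. Qed.

Let le_u X : A X -> (If P U X <= u)%E.
Proof. by move=> AX; apply: ereal_sup_ubound; exists X. Qed.

Let u_gtNy : (-oo < u)%E.
Proof. by apply: lt_le_trans (le_u AX0); have [_ []] := GX0. Qed.

Lemma sup_dom : u = ereal_sup [set If P U X | X in G].
Proof.
apply/eqP; rewrite eq_le; apply/andP; split; last first.
  by apply: le_ereal_sup => _ [X [AX _] <-]; exists X.
apply: ge_ereal_sup => _ [X AX <-].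
have [->|dX] := eqVneq (If P U X) -oo%E; first by rewrite leNye.
apply: ereal_sup_ubound; exists X => //; split=> //; split; first exact: A_orlicz.
by rewrite ltNye.
Qed.

Lemma norm_closure_le X : norm_closure P (Uhat U) A X -> (If P U X <= u)%E.
Proof.
move=> [oX clX]; have [->|dX] := eqVneq (If P U X) -oo%E; first by rewrite leNye.
rewrite -ltNye in dX; have [->|uy] := eqVneq u +oo%E; first by rewrite leey.
have ufin : u \is a fin_num by rewrite fin_numElt u_gtNy ltey.
rewrite (If_utility_fin hU oX dX) -(fineK ufin) lee_fin.
apply: segment_limit_le => t t01.
rewrite -lee_fin (fineK ufin); have /andP[t0 t1] := t01.
(* With [W = (Z - X) / c] this radius gives [(1 - t) (Z - X) = t (1 - 1/l) W], that is [(1 - t) Z +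
   t X0 = (1 - t) X + t (X0 + (1 - 1/l) W)]. *)
pose c := t * (1 - l^-1) / (1 - t).
have c0 : 0 < c by rewrite divr_gt0 ?subr_gt0// mulr_gt0 ?subr_gt0.
have [Z AZ XZ] := clX _ c0.
have oZ := A_orlicz AZ; have oXZ := orliczB hU oX oZ.
have W1 := orlicz_norm_lt hU c0 oXZ XZ.
pose W w := c^-1 * (Z w - X w).
have oW : orlicz P (Uhat U) W by apply: (orliczZ hU _ (orliczB hU oZ oX)).
have W2 : (If P (Uhat U) W <= 1)%E.
  apply: le_trans W1; apply: If_Uhat_le => //.
  - by apply: measurable_funM => //; case: oXZ.
  - by case: oW.
  by move=> w; rewrite /W mulrC !normrM distrC.
have := core_interpolation hU l1 oX0 dX0 (_ : 0 <= t <= 1) oX dX oW W2.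
rewrite (ltW t0) (ltW t1) => /(_ isT) h; apply: le_trans h _.
have t01' : 0 <= t <= 1 by rewrite (ltW t0) (ltW t1).
have := le_u (A_convex t01' AZ AX0); congr (If P U _ <= _)%E.
apply/funext => w; rewrite /W /c; field.
by rewrite !gt_eqF ?subr_gt0//; lra.
Qed.

(** The pointwise inequality [U(X) <= V(Y) + X Y] is integrated; infinite values of [I_U(X)] and
    [I_V(Y)] are split off so that the integral of the sum can be separated. *)
Lemma fenchel_le X Y : orlicz P (Uhat U) X -> orlicz P (Vhat U) Y ->
  (If P U X <= If P (conjV U) Y + 'E_P[(X \* Y)%R])%E.
Proof.
move=> oX oY; have iXY := orlicz_pairing hU oX oY.
have [->|dX] := eqVneq (If P U X) -oo%E; first by rewrite leNye.
rewrite -ltNye in dX; have iX := utility_comp_integrable hU oX dX.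
have mY : measurable_fun setT Y by case: oY.
have V0 w : (0 <= conjV U (Y w))%E by exact: conjV_ge0.
have mV : measurable_fun setT (conjV U \o Y).
  by apply: measurableT_comp => //; exact: measurable_conjV.
have E_fin : 'E_P[(X \* Y)%R]%E \is a fin_num.
  by rewrite unlock; exact: integrable_fin_num.
have [Voo|Voo] := eqVneq (If P (conjV U) Y) +oo%E.
  by rewrite Voo addye ?leey//; apply: contraTneq E_fin => ->.
have iV : P.-integrable setT (conjV U \o Y).
  apply/integrableP; split=> //; under eq_integral do rewrite gee0_abs ?V0//.
  by rewrite ltey.
rewrite unlock -[X in (_ <= X)%E]integralD//.
apply: le_integral_measurable; [exact: measurable_int iX| |].
  by apply: emeasurable_funD => //; exact: measurable_int iXY.
by move=> w /=; rewrite -leeBlDr//; exact: conjV_ge.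
Qed.

Lemma support_funP X Y : G X -> ('E_P[(X \* Y)%R] <= support_fun P G Y)%E.
Proof. by move=> GX; apply: ereal_sup_ubound; exists X. Qed.

Lemma weak_closure_le X Y : weak_closure P (Uhat U) (Vhat U) G X ->
  orlicz P (Vhat U) Y ->
  (If P U X <= If P (conjV U) Y + support_fun P G Y)%E.
Proof.
move=> [oX clX] oY; apply: le_trans (fenchel_le oX oY) _; apply: leeD => //.
apply/lee_addgt0Pr => e e0.
(* The dual variable [Y] itself is the only test function of the weak neighbourhood: [E[Z Y]] is
   within [e] of [E[X Y]]. *)
have [Z GZ /(_ ord0) hZ] := clX 1%N (fun=> Y) e (fun=> oY) e0.
have oZ : orlicz P (Uhat U) Z by exact: A_orlicz GZ.1.
have iXZ := orlicz_pairing hU (orliczB hU oX oZ) oY.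
have iZ := orlicz_pairing hU oZ oY.
apply: le_trans (leeD (support_funP Y GZ) (_ : 'E_P[((X \- Z) \* Y)%R] <= e%:E)%E).
  rewrite unlock -integralD//=; apply: le_integral_measurable.
  - by apply: measurable_int (orlicz_pairing hU oX oY).
  - by apply: emeasurable_funD; [apply: measurable_int iZ|apply: measurable_int iXZ].
  - by move=> w /=; rewrite -EFinD lee_fin mulrBl addrC subrK.
by apply: le_trans (lee_abs _) _; exact: ltW.
Qed.

(** A dual variable whose value does not exceed [u] bounds [I_U] on the weak closure by [u]; the
    existence of such a [Y] is shown further on. *)
Lemma sup_weak_closure (Y : Omega -> R) : orlicz P (Vhat U) Y ->
  (If P (conjV U) Y + support_fun P G Y <= u)%E ->
  u = ereal_sup [set If P U X | X in weak_closure P (Uhat U) (Vhat U) G].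
Proof.
move=> oY Yu; apply/eqP; rewrite eq_le; apply/andP; split; last first.
  apply: ge_ereal_sup => _ [X clX <-]; apply: le_trans Yu; exact: weak_closure_le.
rewrite sup_dom; apply: le_ereal_sup => _ [X GX <-]; exists X => //.
split=> [|n Y' e oY' e0]; first by case: GX => /A_orlicz.
exists X => // i; rewrite (_ : _ \* _ = cst 0) ?expectation_cst ?abse0//.
by apply/funext => w /=; rewrite subrr mul0r.
Qed.

Lemma weak_duality (Y : Omega -> R) : orlicz P (Vhat U) Y ->
  (u <= If P (conjV U) Y + support_fun P G Y)%E.
Proof.
move=> oY; rewrite sup_dom; apply: ge_ereal_sup => _ [X GX <-].
apply: le_trans (fenchel_le (A_orlicz GX.1) oY) _.
by apply: leeD => //; exact: support_funP.
Qed.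

Lemma sup_norm_closure : u = ereal_sup [set If P U X | X in norm_closure P (Uhat U) A].
Proof.
apply/eqP; rewrite eq_le; apply/andP; split; last first.
  by apply: ge_ereal_sup => _ [X clX <-]; exact: norm_closure_le.
apply: le_ereal_sup => _ [X AX <-]; exists X => //; split; first exact: A_orlicz.
move=> e e0; exists X => //; apply: (@le_lt_trans _ _ (e / 2)); last by lra.
apply: ge_inf; first by exists 0 => r /= [/ltW].
split; first by rewrite divr_gt0.
rewrite /If; under eq_integral do rewrite /= subrr mul0r Uhat0//.
by rewrite integral0.
Qed.

End Duality.

(** * Existence of a dual minimizer *)

(** The bound holds everywhere and not only almost surely; these functions form the linear subspace
    on which Hahn-Banach is applied. *)
Definition bounded_rv {R : realType} {dsp : measure_display}
    {Omega : measurableType dsp} : set (Omega -> R) :=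
  [set W : Omega -> R | measurable_fun setT W /\ exists M : R, forall w, `|W w| <= M].

Section ShadowPrice.
Context {R : realType} {dsp : measure_display} {Omega : measurableType dsp}.
Variables (P : probability Omega R) (U : R -> \bar R).
Hypothesis hU : utility U.
Implicit Types X Y Z W : Omega -> R.
Variable A : set (Omega -> R).
Hypothesis A_orlicz : A `<=` orlicz P (Uhat U).
Hypothesis A_convex : forall X Y (t : R), 0 <= t <= 1 -> A X -> A Y ->
  A (fun w => (1 - t) * X w + t * Y w).
Variables (X0 : Omega -> R) (l : R).
Hypothesis (l1 : 1 < l) (AX0 : A X0).
Hypothesis (dX0 : (-oo < If P U (fun w => l * X0 w)%R)%E).
Variable u : R.
Hypothesis A_le_u : forall X, A X -> (If P U X <= u%:E)%E.

Let D : set (Omega -> R) := bounded_rv.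

Let DD W W' : D W -> D W' -> D (fun w => W w + W' w).
Proof.
move=> [mW [M WM]] [mW' [M' WM']]; split; first exact: measurable_funD.
exists (M + M') => w; apply: le_trans (ler_normD _ _) _; exact: lerD.
Qed.

Let DZ c W : D W -> D (fun w => c * W w).
Proof.
move=> [mW [M WM]]; split; first exact: measurable_funM.
by exists (`|c| * M) => w; rewrite normrM ler_wpM2l.
Qed.

Let oD W : D W -> orlicz P (Uhat U) W.
Proof. by move=> [mW [M WM]]; exact: orlicz_bounded WM. Qed.

Let pert X W (t : R) : A X -> D W -> orlicz P (Uhat U) (fun w => X w + t * W w).
Proof. by move=> AX DW; apply: orliczD => //; [exact: A_orlicz|exact/oD/DZ]. Qed.

(* The difference quotients of the value function
   [W |-> u - sup_(X in A) If P U (X + W)] at 0 in the direction [W]. *)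
Let quot W : set R := [set r | exists X (t v : R),
  [/\ A X, 0 < t, If P U (fun w => X w + t * W w) = v%:E & r = (u - v) / t]].

Let quotZ (c : R) W (r : R) : 0 < c -> quot W r -> quot (fun w => c * W w) (c * r).
Proof.
move=> c0 [X [t [v [AX t0 Xv ->]]]]; exists X, (t / c), v; split => //.
- by rewrite divr_gt0.
- rewrite -Xv; congr If; apply/funext => w; field; rewrite gt_eqF//.
- by field; rewrite !gt_eqF.
Qed.

Let quot_ge0 r : quot (fun=> 0) r -> 0 <= r.
Proof.
move=> [X [t [v [AX t0 Xv ->]]]]; rewrite divr_ge0 ?(ltW t0)// subr_ge0.
rewrite -lee_fin -Xv; have := A_le_u AX; congr (If P U _ <= _)%E.
by apply/funext => w; rewrite mulr0 addr0.
Qed.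

(** By concavity: the combination of [X + t W] and [X' + t' W'] with weights [t' / (t + t')] and
    [t / (t + t')] is [Z + s (W + W')] with [Z] in [A] and [s = t t' / (t + t')]. *)
Let quotD W W' r r' : D W -> D W' -> quot W r -> quot W' r' ->
  exists2 s, quot (fun w => W w + W' w) s & s <= r + r'.
Proof.
move=> DW DW' [X [t [v [AX t0 Xv ->]]]] [X' [t' [v' [AX' t'0 Xv' ->]]]].
have tt0 : 0 < t + t' by rewrite addr_gt0.
pose a := t / (t + t').
have a1 : 1 - a = t' / (t + t') by rewrite /a; field; rewrite gt_eqF.
have a01 : 0 <= a <= 1.
  by rewrite divr_ge0 ?(ltW t0) ?(ltW tt0)//= ler_pdivrMr// mul1r; lra.
have a01' : 0 <= 1 - a <= 1 by lra.
pose Z w := (1 - a) * X w + a * X' w.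
have AZ : A Z by exact: A_convex.
pose s := t * t' / (t + t').
have s0 : 0 < s by rewrite divr_gt0// mulr_gt0.
have oX := pert t AX DW; have oX' := pert t' AX' DW'.
have dX : (-oo < If P U (fun w => X w + t * W w)%R)%E by rewrite Xv ltNyr.
have dX' : (-oo < If P U (fun w => X' w + t' * W' w)%R)%E by rewrite Xv' ltNyr.
have := If_concave hU a01' oX oX' dX dX'.
have := If_concave_gtNy hU a01' oX oX' dX dX'.
have -> : (fun w => (1 - a) * (X w + t * W w) + (1 - (1 - a)) * (X' w + t' * W' w))
    = (fun w => Z w + s * (W w + W' w)).
  by apply/funext => w; rewrite /Z /s /a; field; rewrite gt_eqF.
move=> dZ; have oZ := pert s AZ (DD DW DW').
rewrite (If_utility_fin hU oZ dZ); set z := fine _.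
rewrite Xv Xv' subKr -!EFinM -EFinD lee_fin a1 => h.
exists ((u - z) / s); first by exists Z, s, z; split=> //; exact: If_utility_fin.
have -> : (u - v) / t + (u - v') / t' = (u - (t' / (t + t') * v + a * v')) / s.
  by rewrite /s /a; field; rewrite !gt_eqF.
by rewrite ler_pM2r ?invr_gt0// lerD2l lerN2.
Qed.

(** The core point yields a quotient in every direction: [k] brings [W] into an interval where [U]
    is finite, and [X0] absorbs [(1 - 1/l) k W]. *)
Let quot_neq0 W : D W -> quot W !=set0.
Proof.
move=> /[dup] DW [mW [M WM]]; have [e e0 Ue] := utility_neg_dom hU.
have l0 : 0 < l by rewrite (lt_trans _ l1).
have li1 : 0 < 1 - l^-1 by rewrite subr_gt0 invf_lt1.
have M1 : 0 < `|M| + 1 by rewrite ltr_wpDl.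
pose k := e / (`|M| + 1); have k0 : 0 < k by rewrite divr_gt0.
have kW w : `|k * W w| <= e.
  rewrite normrM (gtr0_norm k0) /k -mulrA ler_piMr ?(ltW e0)//.
  rewrite ler_pdivrMl// mulr1; apply: le_trans (WM w) _.
  by apply: le_trans (ler_norm _) _; rewrite lerDl.
have dW := @If_utility_bounded_below _ _ _ P _ hU _ _ (DZ k DW).1 Ue kW.
have := core_perturbation hU l1 (A_orlicz AX0) dX0 (oD (DZ k DW)) dW.
under [fun w => _ + _]eq_fun do rewrite mulrA.
move=> d; exists ((u - fine (If P U (fun w => X0 w + (1 - l^-1) * k * W w))) /
  ((1 - l^-1) * k)).
exists X0, ((1 - l^-1) * k); eexists; split=> //; first by rewrite mulr_gt0.
exact: (If_utility_fin hU (pert _ AX0 DW)).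
Qed.

Let p W := inf (quot W).

Let DN W : D W -> D (fun w => -1 * W w). Proof. exact: DZ. Qed.

(** The sum of a quotient at [W] and one at [- W] dominates a quotient at 0, which is nonnegative;
    so a single quotient at [- W] bounds all those at [W] from below. *)
Let quot_lb W : D W -> has_lbound (quot W).
Proof.
move=> DW; have [r' qr'] := quot_neq0 (DN DW); exists (- r') => r qr.
have [s] := quotD DW (DN DW) qr qr'.
rewrite (_ : (fun w => _) = fun=> 0).
  by move=> /quot_ge0 s0 sr; rewrite lerNl -subr_ge0 opprK addrC; exact: le_trans sr.
by apply/funext => w; rewrite mulN1r subrr.
Qed.

Let p_le W r : D W -> quot W r -> p W <= r.
Proof. by move=> DW qr; apply: ge_inf => //; exact: quot_lb. Qed.

Let p_ge W r : D W -> (forall s, quot W s -> r <= s) -> r <= p W.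
Proof. by move=> DW h; apply: lb_le_inf => //; exact: quot_neq0. Qed.

(** [R^o] views the reals as a module over themselves, so that scaling in [Omega -> R^o] is the
    pointwise product. *)
Let p_sublinear : @sublinear_on _ (Omega -> R^o) D p.
Proof.
split=> [W W' DW DW'|c W c0 DW].
  rewrite -lerBlDr; apply: p_ge => // r qr.
  rewrite lerBlDr -lerBlDl; apply: p_ge => // r' qr'.
  rewrite lerBlDl; have [s qs sr] := quotD DW DW' qr qr'.
  by apply: le_trans sr; apply: p_le => //; exact: DD.
rewrite mulrC -ler_pdivrMr//; apply: p_ge => // r qr.
rewrite ler_pdivrMr// mulrC; apply: p_le; [exact: DZ|exact: quotZ].
Qed.

(* A supergradient at 0 of the value function [W |-> sup_(X in A) If P U (X + W)]. *)
Lemma shadow_price : exists z : (Omega -> R) -> R,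
  [/\ forall W W', D W -> D W' -> z (fun w => W w + W' w) = z W + z W',
      forall c W, D W -> z (fun w => c * W w) = c * z W,
      forall W, D W -> {ae P, forall w, 0 <= W w} -> 0 <= z W
    & forall X W, A X -> D W -> (If P U (fun w => X w + W w)%R <= (u + z W)%:E)%E].
Proof.
have [f [fD fZ fp]] := @hahn_banach _ (Omega -> R^o) D DD DZ p p_sublinear.
exists (fun W => - f W); split.
- by move=> W W' DW DW'; rewrite (fD _ _ DW DW') opprD.
- by move=> c W DW; rewrite (fZ _ _ DW) mulrN.
- move=> W DW W0; rewrite oppr_ge0 leNgt; apply/negP => fW.
  have d0 := core_dom hU l1 (A_orlicz AX0) dX0.
  have X0fin := If_utility_fin hU (A_orlicz AX0) d0.
  set v0 := fine _ in X0fin.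
  have v0u : v0 <= u by rewrite -lee_fin -X0fin; exact: A_le_u.
  (* Moving from [X0] by [t W] does not lower the utility, so [t f W <= u - v <= u - v0]; this [t]
     makes [t f W = u - v0 + 1], a contradiction. *)
  pose t := (u - v0 + 1) / f W.
  have t0 : 0 < t by rewrite divr_gt0//; lra.
  have oX := pert t AX0 DW.
  have XX0 : (If P U X0 <= If P U (fun w => X0 w + t * W w)%R)%E.
    have mU := measurable_utility hU.
    apply: ae_le_integral_measurable.
    + by apply: measurableT_comp => //; case: (A_orlicz AX0).
    + by apply: measurableT_comp => //; case: oX.
    + apply: filterS W0 => w W0; apply: ut_nondecreasing => //.
      by rewrite lerDl mulr_ge0// ltW.
  have dX := lt_le_trans d0 XX0.
  have Xfin := If_utility_fin hU oX dX; set v := fine _ in Xfin.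
  rewrite X0fin Xfin lee_fin in XX0.
  have /(p_le DW) : quot W ((u - v) / t) by exists X0, t, v.
  move=> /(le_trans (fp _ DW)); rewrite ler_pdivlMr// /t mulrCA divff ?gt_eqF//.
  by lra.
- move=> X W AX DW.
  have XW : (fun w => X w + W w) = (fun w => X w + 1 * W w).
    by apply/funext => w; rewrite mul1r.
  have [->|dX] := eqVneq (If P U (fun w => X w + W w)) -oo%E; first by rewrite leNye.
  rewrite -ltNye in dX.
  have oX : orlicz P (Uhat U) (fun w => X w + W w) by rewrite XW; exact: pert.
  rewrite (If_utility_fin hU oX dX) lee_fin; set v := fine _.
  have /(p_le DW) : quot W ((u - v) / 1).
    by exists X, 1, v; split=> //; rewrite -XW; exact: If_utility_fin.
  by move=> /(le_trans (fp _ DW)); rewrite divr1; lra.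
Qed.

End ShadowPrice.

(** * The density of a positive functional *)

Section DualDensity.
Context {R : realType} {dsp : measure_display} {Omega : measurableType dsp}.
Variables (P : probability Omega R) (z : (Omega -> R) -> R).
Implicit Types (W s : Omega -> R) (A B : set Omega).

Let D : set (Omega -> R) := bounded_rv.

Hypothesis zD : forall W W', D W -> D W' -> z (fun w => W w + W' w) = z W + z W'.
Hypothesis zZ : forall c W, D W -> z (fun w => c * W w) = c * z W.
Hypothesis z_ge0 : forall W, D W -> {ae P, forall w, 0 <= W w} -> 0 <= z W.

Lemma bounded_indic A : measurable A -> D \1_A.
Proof.
move=> mA; split; first exact: measurable_indic.
by exists 1 => w; rewrite indicE; case: (_ \in _); rewrite ?normr1 ?normr0.
Qed.

Lemma bounded_mul_indic W A : D W -> measurable A -> D (fun w => W w * \1_A w).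
Proof.
move=> [mW [M WM]] mA; split; first by apply: measurable_funM => //; exact: measurable_indic.
exists M => w; rewrite indicE; case: (_ \in _); rewrite ?mulr1 ?mulr0// normr0.
exact: le_trans (WM w).
Qed.

(** The decomposition of finitely additive set functions is applied to [A |-> z \1_A]; real-valued
    integrals of products with indicators replace the integrals over sets. *)
Lemma positive_functional_density : exists Y : Omega -> R,
  [/\ measurable_fun setT Y, forall w, 0 <= Y w,
      P.-integrable setT (EFin \o Y),
      forall A, measurable A -> \int[P]_w (\1_A w * Y w) <= z \1_A
    & forall eps, 0 < eps -> exists E : nat -> set Omega,
        [/\ forall n, measurable (E n), nondecreasing_seq E,
            \bigcup_n E n = setT
          & forall n, z \1_(E n) <= \int[P]_w (\1_(E n) w * Y w) + eps]].
Proof.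
have z_indic_ge0 A : measurable A -> 0 <= z \1_A.
  move=> mA; apply: z_ge0; first exact: bounded_indic.
  by apply: aeW => w; rewrite indicE; case: (_ \in _).
have z_indicD A B : measurable A -> measurable B -> A `&` B = set0 ->
    z \1_(A `|` B) = z \1_A + z \1_B.
  move=> mA mB AB; rewrite -zD; [|exact: bounded_indic..].
  congr z; apply/funext => w; rewrite !indicE in_setU.
  have [wA|wA] := boolP (w \in A); have [wB|wB] := boolP (w \in B);
    rewrite /= ?addr0 ?add0r//.
  by move: wA wB; rewrite !inE => wA wB; have : (A `&` B) w by []; rewrite AB.
have z_indic_null A : measurable A -> P A = 0%E -> z \1_A = 0.
  move=> mA PA; apply/eqP; rewrite eq_le z_indic_ge0// andbT.
  have DA := bounded_indic mA.
  (* For a null set [A], [- \1_A] is almost surely nonnegative too, hence [z \1_A <= 0]. *)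
  rewrite -oppr_ge0 -mulN1r -zZ//; apply: z_ge0.
    split; first exact: measurable_funM (DA.1).
    by have [_ [M hM]] := DA; exists M => w; rewrite mulN1r normrN.
  exists A; split=> // w /= /negP; rewrite indicE.
  have [wA|_] := boolP (w \in A); first by move=> _; exact: set_mem.
  by rewrite mulr0 lexx.
have [Y [mY Y0 iY leY epsY]] :=
  finitely_additive_density z_indic_ge0 z_indicD z_indic_null.
have JE A : measurable A ->
    (\int[P]_w (\1_A w * Y w))%:E = (\int[P]_(w in A) (Y w)%:E)%E.
  move=> mA; rewrite [in RHS]integral_mkcond; rewrite /Rintegral fineK.
    by apply: eq_integral => w _; rewrite patchE indicE; case: ifPn => _;
      rewrite ?mul1r ?mul0r.
  apply: integrable_fin_num => //.
  apply: (le_integrable measurableT _ _ iY) => [|w _ /=].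
    by apply/measurable_EFinP/measurable_funM => //; exact: measurable_indic.
  rewrite lee_fin normrM indicE ler_piMl//.
  by case: (_ \in _); rewrite ?normr1 ?normr0.
exists Y; split=> //.
  by move=> A mA; rewrite -lee_fin JE//; exact: leY.
move=> eps e0; have [E [mE ndE covE hE]] := epsY _ e0.
by exists E; split=> // n; rewrite -lee_fin EFinD JE.
Qed.

End DualDensity.

(** * Measurable selection of nearly optimal perturbations *)

Section Selection.
Context {R : realType} {dsp : measure_display} {Omega : measurableType dsp}.
Variables (P : probability Omega R) (U : R -> \bar R).
Hypothesis hU : utility U.
Variables (z : (Omega -> R) -> R) (Y : Omega -> R).
Implicit Types (W s : Omega -> R) (A B : set Omega).

Let D : set (Omega -> R) := bounded_rv.

Hypothesis zD : forall W W', D W -> D W' -> z (fun w => W w + W' w) = z W + z W'.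
Hypothesis zZ : forall c W, D W -> z (fun w => c * W w) = c * z W.
Hypothesis mY : measurable_fun setT Y.
Hypothesis Y0 : forall w, 0 <= Y w.
Hypothesis iY : P.-integrable setT (EFin \o Y).
Hypothesis Y_le_z : forall A, measurable A -> \int[P]_w (\1_A w * Y w) <= z \1_A.
Hypothesis Y_approx_z : forall eps, 0 < eps -> exists E : nat -> set Omega,
  [/\ forall n, measurable (E n), nondecreasing_seq E, \bigcup_n E n = setT
    & forall n, z \1_(E n) <= \int[P]_w (\1_(E n) w * Y w) + eps].

Let J W := \int[P]_w (W w * Y w).

Let iWY W : D W -> P.-integrable setT (EFin \o (fun w => W w * Y w)).
Proof.
move=> [mW [M WM]].
apply: (@le_integrable _ _ _ P _ measurableT _ (fun w => `|M|%:E * (Y w)%:E)%E) => //.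
- by apply/measurable_EFinP; exact: measurable_funM.
- move=> w _ /=; rewrite lee_fin !normrM normr_id ler_wpM2r//.
  by apply: le_trans (WM w) _; exact: ler_norm.
- exact: integrableZl.
Qed.

(* The purely finitely additive part of [z]. *)
Let sing W := z W - J W.

Let singD W W' : D W -> D W' -> sing (fun w => W w + W' w) = sing W + sing W'.
Proof.
move=> DW DW'; rewrite /sing zD// /J.
under eq_Rintegral do rewrite mulrDl.
by rewrite RintegralD//; [lra|exact: iWY..].
Qed.

Let singZ c W : D W -> sing (fun w => c * W w) = c * sing W.
Proof.
move=> DW; rewrite /sing zZ// /J.
under eq_Rintegral do rewrite -mulrA.
by rewrite RintegralZl// ?mulrBr//; exact: iWY.
Qed.

Let sing_ge0 A : measurable A -> 0 <= sing \1_A.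
Proof. by move=> mA; rewrite subr_ge0; exact: Y_le_z. Qed.

(** A bound uniform in [A], satisfied by simple random variables: it makes [sing] of [s \1_(E n)]
    small together with [sing \1_(E n)]. *)
Let controlled s := D s /\ exists2 M, 0 <= M &
  forall A, measurable A -> sing (fun w => s w * \1_A w) <= M * sing \1_A.

Let controlled0 : controlled (fun=> 0).
Proof.
split; first by split=> //; exists 0 => w; rewrite normr0.
exists 0 => // A mA; have DA := bounded_indic (R := R) mA.
by rewrite (singZ 0 DA) !mul0r.
Qed.

(** [A] is split along [b]: where [b] holds, [sing] is linear in the constant [q]; elsewhere the
    bound for [s] applies. *)
Let controlled_if s (q : R) (b : Omega -> bool) : controlled s ->
  measurable_fun setT b -> controlled (fun w => if b w then q else s w).
Proof.
move=> [Ds [M M0 hM]] mb; have [ms [N sN]] := Ds.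
split.
  split; first exact: measurable_fun_ifT.
  exists (Num.max `|q| N) => w; case: (b w); rewrite le_max ?lexx//.
  by rewrite sN orbT.
exists (Num.max M `|q|); first by rewrite le_max M0.
move=> A mA; pose B := [set w | b w].
have mB : measurable B.
  by rewrite -[B]setTI; exact: (mb measurableT [set true]).
have mAB := measurableI _ _ mA mB; have mAD := measurableD mA mB.
have bB w : (w \in B) = b w by rewrite mem_setE.
have DAB := bounded_indic (R := R) mAB; have DAD := bounded_indic (R := R) mAD.
have -> : (fun w => (if b w then q else s w) * \1_A w) =
    (fun w => s w * \1_(A `\` B) w + q * \1_(A `&` B) w).
  apply/funext => w; rewrite !indicE in_setI in_setD bB.
  by case: (w \in A); case: (b w); rewrite /= ?mulr0 ?addr0 ?add0r.
have -> : \1_A = (fun w => \1_(A `\` B) w + \1_(A `&` B) w) :> (Omega -> R).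
  apply/funext => w; rewrite !indicE in_setI in_setD bB.
  by case: (w \in A); case: (b w); rewrite /= ?addr0 ?add0r.
rewrite !singD//; last 2 first.
- exact: bounded_mul_indic.
- split; first exact: measurable_funM (DAB.1).
  have [_ [K hK]] := DAB; exists (`|q| * K) => w.
  by rewrite normrM ler_wpM2l.
rewrite singZ// [leRHS]mulrDr; have s1 := sing_ge0 mAB; have s2 := sing_ge0 mAD.
apply: lerD.
  by apply: le_trans (hM _ mAD) _; rewrite ler_wpM2r// le_max lexx.
by rewrite ler_wpM2r// le_max ler_norm orbT.
Qed.

Variables (X : Omega -> R) (u : R).
Hypothesis oX : orlicz P (Uhat U) X.
Hypothesis dX : (-oo < If P U X)%E.
Hypothesis UX : forall w, (-oo < U (X w))%E.
Hypothesis z_le : forall W, D W ->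
  (If P U (fun w => X w + W w)%R <= (u + z W)%:E)%E.

Let mX : measurable_fun setT X. Proof. by case: oX. Qed.

Let mU W : measurable_fun setT W -> measurable_fun setT (fun w => U (W w)).
Proof. by move=> mW; apply: measurableT_comp => //; exact: measurable_utility. Qed.

Let UXE w : U (X w) = (fine (U (X w)))%:E.
Proof. exact: utility_real. Qed.

(** The utility of [X w + r] net of the cost of [r] at the price [Y w]; its supremum over [r] is
    [V(Y) + X Y], its value at [r = 0] is [U(X)]. *)
Let gain (r : R) w : \bar R := (U (X w + r)%R - (r * Y w)%:E)%E.

Let m_gain s : measurable_fun setT s -> measurable_fun setT (fun w => gain (s w) w).
Proof.
move=> ms; apply: emeasurable_funB; first by apply: mU; exact: measurable_funD.
by apply/measurable_EFinP; exact: measurable_funM.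
Qed.

(** For [W = s \1_(E n)], [z_le] gives [I_U(X + W) <= u + E[W Y] + sing W] with [sing W <= M eps].
    Outside [E n] nothing changes, so this bounds the integral of the gain over [E n]; then [n]
    tends to infinity and [eps] to 0. *)
Let controlled_gain s : controlled s -> (forall w, U (X w) <= gain (s w) w)%E ->
  (\int[P]_w (gain (s w) w - U (X w)) <= u%:E - If P U X)%E.
Proof.
move=> [Ds [M M0 hM]] sX; have [ms [N sN]] := Ds.
pose H w := (gain (s w) w - U (X w))%E.
have H0 w : (0 <= H w)%E by rewrite /H UXE sube_ge0// -UXE.
have mH : measurable_fun setT H by apply: emeasurable_funB; [exact: m_gain|exact: mU].
rewrite (If_utility_fin hU oX dX); set c := fine _.
apply/lee_addgt0Pr => e e0; pose eps := e / (M + 1).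
have M1 : 0 < M + 1 by rewrite ltr_wpDl.
have eps0 : 0 < eps by rewrite divr_gt0.
have Meps : M * eps <= e.
  by rewrite /eps mulrCA ler_piMr ?(ltW e0)// ler_pdivrMr// mul1r lerDl.
have [E [mE ndE covE hE]] := Y_approx_z eps0.
have := @ge0_nondecreasing_set_cvg_integral _ _ _ E H P ndE mE
  (fun i => measurable_funTS mH) (fun i x _ => H0 x).
rewrite covE => /cvg_lim <-//; apply: lime_le.
  by apply: ereal_nondecreasing_is_cvgn; apply:
    ge0_nondecreasing_set_nondecreasing_integral => // i; exact: measurable_funTS.
apply: nearW => n.
pose W w := s w * \1_(E n) w.
have DW : D W by exact: bounded_mul_indic.
have oXW : orlicz P (Uhat U) (fun w => X w + W w).
  by apply: orliczD => //; case: DW => mW [K hK]; exact: orlicz_bounded hK.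
have mXW : measurable_fun setT (fun w => X w + W w) by case: oXW.
have iX := utility_comp_integrable hU oX dX.
have iWYn := iWY DW.
(* This integrable lower bound ensures that [X + W] has finite expected utility. *)
have XWle w : (U (X w) + (W w * Y w)%:E <= U (X w + W w)%R)%E.
  rewrite /W indicE; case: (w \in E n); last by rewrite mulr0 mul0r adde0 addr0.
  by rewrite mulr1 -leeBrDr//; exact: sX.
have dXW : (-oo < If P U (fun w => X w + W w)%R)%E.
  apply: (@lt_le_trans _ _ (\int[P]_w (U (X w) + (W w * Y w)%:E))%E).
    by rewrite integralD//; rewrite ltNye_eq fin_numD !integrable_fin_num.
  apply: le_integral_measurable => //; last exact: mU.
  apply: emeasurable_funD; first exact: mU.
  exact: measurable_int iWYn.
have iXW := utility_comp_integrable hU oXW dXW.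
have -> : (\int[P]_(w in E n) H w =
    \int[P]_w (U (X w + W w)%R - (W w * Y w)%:E - U (X w)))%E.
  rewrite integral_mkcond; apply: eq_integral => w _; rewrite patchE /H /gain /W indicE.
  case: (w \in E n); first by rewrite mulr1.
  by rewrite mulr0 mul0r addr0 sube0 UXE subee.
rewrite integralB//; last exact: integrableB.
rewrite integralB//.
have -> : (\int[P]_w (W w * Y w)%:E)%E = (J W)%:E.
  by rewrite /J /Rintegral fineK//; exact: integrable_fin_num.
have -> : (\int[P]_w U (X w))%E = c%:E by rewrite -(If_utility_fin hU oX dX).
apply: (@le_trans _ _ ((u + z W)%:E - (J W)%:E - c%:E)%E).
  by rewrite leeB// leeB//; exact: z_le.
rewrite -!EFinB -EFinD lee_fin.
have := hM _ (mE n); rewrite {1}/sing -/W -/(W) => h.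
have hn : sing \1_(E n) <= eps by have := hE n; rewrite /sing /J; lra.
have := le_trans h (ler_wpM2l M0 hn); lra.
Qed.

Let q_ (n : nat) : R := if unpickle n is Some r then ratr r else 0.

(** After [n] steps the value at [w] maximizes the gain among 0 and the first [n] terms of the
    enumeration [q_]. Finitely many case distinctions build it, so it stays controlled. *)
Fixpoint selection n : Omega -> R :=
  if n is n'.+1 then fun w =>
    if (gain (selection n' w) w < gain (q_ n') w)%E then q_ n' else selection n' w
  else fun=> 0.

Let selection_controlled n : controlled (selection n).
Proof.
elim: n => [|n ih] /=; first exact: controlled0.
apply: controlled_if => //; apply: measurable_fun_lte; apply: m_gain => //.
exact: ih.1.1.
Qed.

Let selection_nd w : {homo (fun n => gain (selection n w) w) : m n / (m <= n)%N >->
  (m <= n)%E}.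
Proof.
apply/nondecreasing_seqP => n /=.
by case: ifPn => // /ltW.
Qed.

Let selection_ge n w : (gain (q_ n) w <= gain (selection n.+1 w) w)%E.
Proof. by rewrite /=; case: ifPn => // ; rewrite -leNgt. Qed.

Let gain0 w : gain 0 w = U (X w).
Proof. by rewrite /gain addr0 mul0r sube0. Qed.

Let selection_ge0 n w : (U (X w) <= gain (selection n w) w)%E.
Proof. by have := selection_nd w (leq0n n); rewrite /= gain0. Qed.

(* [U] being monotone, the supremum defining [conjV U] may be restricted to the
   points [X w + q] with [q] rational. *)
Let conjV_selection w :
  (conjV U (Y w) - (U (X w) - (X w * Y w)%:E) <=
   ereal_sup (range (fun n => gain (selection n w) w - U (X w))))%E.
Proof.
set L := ereal_sup _; have UXw := UXE w; set r := fine _ in UXw.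
rewrite UXw -EFinB leeBlDr//.
apply: ge_ereal_sup => _ [x _ <-].
have [->|Ux] := eqVneq (U x) -oo%E; first by rewrite addNye leNye.
rewrite -ltNye in Ux; rewrite (utility_real hU Ux); set a := fine _.
apply/lee_addgt0Pr => e e0.
have Yw1 : 0 < Y w + 1 by rewrite ltr_wpDl.
(* A rational [q] slightly above [x - X w] keeps [U(X w + q) >= U(x)] by monotonicity and costs at
   most [e] more; [Y w + 1] replaces [Y w], which may vanish. *)
have xe : x - X w < x - X w + e / (Y w + 1) by rewrite ltrDl divr_gt0.
have [p] := rat_in_itvoo xe; set q := ratr p; rewrite in_itv/= => /andP[q1 q2].
have qE : q_ (pickle p) = q by rewrite /q_ pickleK.
have aU : (a%:E <= U (X w + q)%R)%E.
  by rewrite -(utility_real hU Ux); apply: ut_nondecreasing => //; lra.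
have : ((a - q * Y w - r)%:E <= L)%E.
  apply: (@le_trans _ _ (gain (selection (pickle p).+1 w) w - U (X w))%E); last first.
    by apply: ereal_sup_ubound; exists (pickle p).+1.
  rewrite UXw EFinB leeB// (le_trans _ (selection_ge _ _))// qE EFinB.
  by rewrite leeB.
have qe : (q + X w - x) * Y w <= e.
  apply: (@le_trans _ _ (e / (Y w + 1) * Y w)).
    by rewrite ler_wpM2r//; lra.
  by rewrite mulrAC ler_pdivrMr// ler_wpM2l ?(ltW e0)// lerDl.
case: L => [L| |]; last by rewrite leeNy_eq.
  by rewrite -!EFinB -!EFinD !lee_fin; lra.
by move=> _; rewrite !addye// leey.
Qed.

(** Monotone convergence along the selection. By Fenchel's inequality the integrand is nonnegative,
    so its integral makes sense before [V(Y)] and [X Y] are known to be integrable. *)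
Lemma dual_integral_le :
  (\int[P]_w (conjV U (Y w) - (U (X w) - (X w * Y w)%:E)) <= u%:E - If P U X)%E.
Proof.
pose H n w := (gain (selection n w) w - U (X w))%E.
have mH n : measurable_fun setT (H n).
  by apply: emeasurable_funB; [apply: m_gain; exact: (selection_controlled n).1.1|exact: mU].
have H0 n w : (0 <= H n w)%E by rewrite /H UXE sube_ge0// -UXE.
have ndH w : {homo H ^~ w : m n / (m <= n)%N >-> (m <= n)%E}.
  by move=> m n mn; rewrite /H leeB//; exact: selection_nd.
have cvgH := @cvg_monotone_convergence _ _ _ P _ measurableT H mH
  (fun n w _ => H0 n w) (fun w _ => ndH w).
apply: (@le_trans _ _ (\int[P]_w limn (H ^~ w))%E).
  apply: le_integral_measurable.
  - apply: emeasurable_funB.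
      by apply: (measurableT_comp (measurable_conjV U)).
    by apply: emeasurable_funB; [exact: mU|apply/measurable_EFinP; exact: measurable_funM].
  - apply: (emeasurable_fun_cvg H) => // w _; exact: ereal_nondecreasing_is_cvgn.
  move=> w; have /cvg_lim -> // := ereal_nondecreasing_cvgn (ndH w).
  exact: conjV_selection.
rewrite -(cvg_lim _ cvgH)//; apply: lime_le.
  exact: cvgP cvgH.
by apply: nearW => n; exact: controlled_gain (selection_controlled n) (selection_ge0 n).
Qed.

End Selection.

(** * Duality for a convex set meeting the core *)

Section AbstractDuality.
Context {R : realType} {dsp : measure_display} {Omega : measurableType dsp}.
Variables (P : probability Omega R) (U : R -> \bar R).
Hypothesis hU : utility U.
Implicit Types X Y Z W : Omega -> R.

Lemma Vhat_le_conjV y : 0 <= y -> (Vhat U y <= conjV U y)%E.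
Proof.
move=> y0; apply: ge_ereal_sup => _ [x _ <-].
apply: le_trans (conjV_ge U (- `|x|) y); rewrite /Uhat oppeK addeC.
by rewrite leeD2l// mulNr EFinN oppeK lee_fin ler_wpM2r// ler_norm.
Qed.

(** The pointwise selection wants [U(X)] finite everywhere; on the null set where it is [-oo], [X]
    is replaced by 0. *)
Lemma finite_utility_modification X : orlicz P (Uhat U) X -> (-oo < If P U X)%E ->
  exists X', [/\ orlicz P (Uhat U) X', {ae P, forall w, X w = X' w} &
    forall w, (-oo < U (X' w))%E].
Proof.
move=> oX dX; have mX : measurable_fun setT X by case: oX.
have iX := utility_comp_integrable hU oX dX.
pose X' w := if (-oo < U (X w))%E then X w else 0.
have mX' : measurable_fun setT X'.
  apply: measurable_fun_ifT => //; apply: measurable_fun_lte => //.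
  by apply: measurableT_comp => //; exact: measurable_utility.
have XX' : {ae P, forall w, X w = X' w}.
  have := integrable_ae measurableT iX; apply: filterS => w /(_ I) /=.
  by rewrite /X' fin_numElt => /andP[->].
exists X'; split=> //.
  by apply: (orlicz_le hU oX) => //; apply: filterS XX' => w ->.
by move=> w; rewrite /X'; case: ifPn => // _; rewrite (ut_at0 hU) ltNyr.
Qed.

Variable A : set (Omega -> R).
Hypothesis A_orlicz : A `<=` orlicz P (Uhat U).
Hypothesis A_convex : forall X Y (t : R), 0 <= t <= 1 -> A X -> A Y ->
  A (fun w => (1 - t) * X w + t * Y w).
Hypothesis A_core : A `&` coreI P U !=set0.

Let u := ereal_sup [set If P U X | X in A].

Let G := A `&` domI P U.

Let mU X : measurable_fun setT X -> measurable_fun setT (fun w => U (X w)).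
Proof. by move=> mX; apply: measurableT_comp => //; exact: measurable_utility. Qed.

(** [Y] is the density of the countably additive part of the shadow price. First [V(Y)] is shown
    integrable, which puts [Y] in the Orlicz space; then [E[X Y]] is finite and the bound on the
    integral of [V(Y) + X Y - U(X)] can be rearranged. *)
Lemma dual_attained : (u < +oo)%E -> exists2 Y, orlicz_plus P (Vhat U) Y &
  (If P (conjV U) Y + support_fun P G Y <= u)%E.
Proof.
move=> uy; have [X0 [AX0 [oX0 [l l1 dX0]]]] := A_core.
have d0 := core_dom hU l1 oX0 dX0.
have le_u X : A X -> (If P U X <= u)%E.
  by move=> AX; apply: ereal_sup_ubound; exists X.
have ufin : u \is a fin_num by rewrite fin_numElt uy (lt_le_trans d0)// le_u.
have uE : u = (fine u)%:E by rewrite fineK.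
have le_fu X : A X -> (If P U X <= (fine u)%:E)%E by rewrite -uE; exact: le_u.
have [z [zD zZ z0 zle]] := shadow_price hU A_orlicz A_convex l1 AX0 dX0 le_fu.
have [Y [mY Y0 iY Yz Yeps]] := positive_functional_density zD zZ z0.
have key X : A X -> orlicz P (Uhat U) X -> (-oo < If P U X)%E -> exists X',
    [/\ orlicz P (Uhat U) X', {ae P, forall w, X w = X' w},
        If P U X = If P U X', (forall w, (-oo < U (X' w))%E) &
      (\int[P]_w (conjV U (Y w) - (U (X' w) - (X' w * Y w)%:E)) <= u - If P U X')%E].
  move=> AX oX dX; have [X' [oX' XX' UX']] := finite_utility_modification oX dX.
  have mX : measurable_fun setT X by case: oX.
  have mX' : measurable_fun setT X' by case: oX'.
  have IXX' := If_ae_eq (measurable_utility hU) mX mX' XX'.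
  exists X'; split=> //; rewrite uE; apply: (dual_integral_le hU zD zZ) => //.
    by rewrite -IXX'.
  move=> W [mW [M WM]].
  apply: le_trans (_ : If P U (fun w => X w + W w)%R <= _)%E; last first.
    by apply: zle => //; split=> //; exists M.
  rewrite (If_ae_eq (measurable_utility hU) _ _ (_ : {ae P, forall w, X' w + W w = X w + W w}))//.
  - exact: measurable_funD.
  - exact: measurable_funD.
  - by apply: filterS XX' => w ->.
have V0 w : (0 <= conjV U (Y w))%E by exact: conjV_ge0.
have mV : measurable_fun setT (fun w => conjV U (Y w)).
  by apply: (measurableT_comp (measurable_conjV U)).
have mv X : measurable_fun setT X -> measurable_fun setT
    (fun w => conjV U (Y w) - (U (X w) - (X w * Y w)%:E))%E.
  move=> mX; apply: emeasurable_funB => //; apply: emeasurable_funB; first exact: mU.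
  by apply/measurable_EFinP; exact: measurable_funM.
have v0 X w : (-oo < U (X w))%E ->
    (0 <= conjV U (Y w) - (U (X w) - (X w * Y w)%:E))%E.
  move=> UX; rewrite sube_ge0 ?conjV_ge//.
  by rewrite (utility_real hU UX) -EFinB.
have l0 : 0 < l by rewrite (lt_trans _ l1).
(* Fenchel's inequality at [l X0] bounds [- X0 Y] by [(V(Y) - U(l X0)) / l], so [(1 - 1/l) V(Y)] is
   at most [V(Y) + X0 Y - U(X0)], whose integral is finite, plus [|U(X0)| + |U(l X0)| / l]. *)
have IV : (If P (conjV U) Y < +oo)%E.
  have [X' [oX' XX' _ UX' hX']] := key _ AX0 oX0 d0.
  have mX' : measurable_fun setT X' by case: oX'.
  have olX' := orliczZ hU l oX'.
  have dlX' : (-oo < If P U (fun w => l * X' w)%R)%E.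
    rewrite -(If_ae_eq (X := fun w => l * X0 w) (measurable_utility hU))//.
    + by case: (orliczZ hU l oX0).
    + by case: olX'.
    + by apply: filterS XX' => w ->.
  have i1 := utility_comp_integrable hU olX' dlX'.
  have dX' : (-oo < If P U X')%E.
    rewrite -(If_ae_eq (measurable_utility hU) _ _ XX')//; by case: oX0.
  have i2 := utility_comp_integrable hU oX' dX'.
  have vfin : (\int[P]_w (conjV U (Y w) - (U (X' w) - (X' w * Y w)%:E)) < +oo)%E.
    by apply: le_lt_trans hX' _; rewrite uE (If_utility_fin hU oX' dX') -EFinB ltry.
  have li : 0 < 1 - l^-1 by rewrite subr_gt0 invf_lt1.
  have : (\int[P]_w ((1 - l^-1)%:E * conjV U (Y w)) < +oo)%E.
    apply: (@le_lt_trans _ _ (\int[P]_w (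
        (conjV U (Y w) - (U (X' w) - (X' w * Y w)%:E)) +
        (`|U (X' w)| + l^-1%:E * `|U (l * X' w)%R|)))%E).
      apply: le_integral_measurable.
      - exact: emeasurable_funM.
      - apply: emeasurable_funD; first exact: mv.
        apply: emeasurable_funD; first by apply: measurableT_comp => //; exact: mU.
        apply: emeasurable_funM => //; apply: measurableT_comp => //; apply: mU.
        by case: olX'.
      move=> w; have := conjV_ge U (l * X' w) (Y w); have := V0 w.
      rewrite (utility_real hU (UX' w)); move: (fine _) => a.
      case: (conjV U (Y w)) => [b| |]// _; last first.
        by move=> _; rewrite -EFinB addye ?leey// gt_eqF// (@lt_le_trans _ _ 0%E)//
          adde_ge0// mule_ge0// lee_fin invr_ge0 (ltW l0).
      have [->|Ul] := eqVneq (U (l * X' w)%R) -oo%E.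
        by move=> _; rewrite [`|-oo|%E]/= gt0_muley ?lte_fin ?invr_gt0// [X in (_ + X)%E]addey// -!EFinB addey ?leey.
      rewrite -ltNye in Ul; rewrite (utility_real hU Ul); move: (fine _) => e.
      rewrite [`|e%:E|%E]/= [`|a%:E|%E]/= -!EFinM -!EFinB -!EFinD !lee_fin => h.
      have h1 := ler_norm a; have h2 : - `|e| <= e by rewrite lerNl -normrN ler_norm.
      have : l^-1 * (e - l * X' w * Y w) <= l^-1 * b by rewrite ler_pM2l// invr_gt0.
      have -> : l^-1 * (e - l * X' w * Y w) = l^-1 * e - X' w * Y w.
        by field; rewrite gt_eqF.
      have : l^-1 * - `|e| <= l^-1 * e by rewrite ler_pM2l// invr_gt0.
      lra.
    rewrite ge0_integralD//; last 4 first.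
    - by move=> w _; exact: v0.
    - exact: mv.
    - by move=> w _; rewrite adde_ge0// mule_ge0// lee_fin invr_ge0 (ltW l0).
    - apply: emeasurable_funD; first by apply: measurableT_comp => //; exact: mU.
      apply: emeasurable_funM => //; apply: measurableT_comp => //; apply: mU.
      by case: olX'.
    apply: lte_add_pinfty => //.
    have : P.-integrable setT (fun w => `|U (X' w)| + l^-1%:E * `|U (l * X' w)%R|)%E.
      apply: integrableD => //; first exact: (integrable_abse i2).
      by apply: integrableZl => //; exact: (integrable_abse i1).
    by move=> /(integrable_fin_num measurableT); rewrite fin_numElt => /andP[].
  rewrite ge0_integralZl_EFin//; last by rewrite ltW.
  rewrite /If ltey => h; rewrite ltey; apply: contraNneq h => ->.
  by rewrite gt0_muley.
have oY : orlicz P (Vhat U) Y.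
  split=> //; exists 1 => //; apply: le_lt_trans IV; apply: ge0_le_integral => //.
  - by move=> w _; exact: Vhat_ge0.
  - by apply: (measurableT_comp (measurable_Vhat U)); exact: measurable_funM.
  - by move=> w _; rewrite mul1r; exact: Vhat_le_conjV.
exists Y; first by split=> //; split=> //; exact: aeW.
have IVfin : If P (conjV U) Y \is a fin_num by rewrite ge0_fin_numE// integral_ge0.
rewrite -leeBrDl//; apply: ge_ereal_sup => _ [X [AX [oX dX]] <-].
rewrite leeBrDl//.
have [X' [oX' XX' IX' UX' hX']] := key _ AX oX dX.
have dX' : (-oo < If P U X')%E by rewrite -IX'.
have i1 := utility_comp_integrable hU oX' dX'.
have iV : P.-integrable setT (fun w => conjV U (Y w)).
  apply/integrableP; split=> //; under eq_integral do rewrite gee0_abs ?V0//.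
  exact: IV.
have i2 := orlicz_pairing hU oX' oY.
have -> : 'E_P[(X \* Y)%R]%E = (\int[P]_w (X' w * Y w)%:E)%E.
  rewrite unlock; apply: ae_eq_integral => //.
  - exact: measurable_int (orlicz_pairing hU oX oY).
  - exact: measurable_int i2.
  - by apply: filterS XX' => w /= ->.
(* All terms are now integrable, and [I_U(X')] cancels on both sides. *)
move: hX'; rewrite integralB//; last exact: integrableB.
rewrite integralB// -/(If P (conjV U) Y) -/(If P U X').
rewrite uE (If_utility_fin hU oX' dX') -(fineK IVfin).
have E2 := integrable_fin_num measurableT i2; rewrite -(fineK E2).
rewrite -!EFinB -EFinD !lee_fin; lra.
Qed.

Theorem convex_utility_duality :
  [/\ u = ereal_sup [set If P U X | X in norm_closure P (Uhat U) A],
      u = ereal_sup [set If P U X | X in G],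
      u = ereal_sup [set If P U X | X in weak_closure P (Uhat U) (Vhat U) G]
    & is_min [set (If P (conjV U) Y + support_fun P G Y)%E |
            Y in orlicz_plus P (Vhat U)] u].
Proof.
have [X0 [AX0 [oX0 [l l1 dX0]]]] := A_core.
have [Y oY Yu] : exists2 Y, orlicz_plus P (Vhat U) Y &
    (If P (conjV U) Y + support_fun P G Y <= u)%E.
  have [uy|] := ltP u +oo%E; first exact: dual_attained.
  (* If [u = +oo] the bound holds for every [Y], and [Y = 0] is taken; weak duality then makes all
     dual values infinite. *)
  rewrite leye_eq => /eqP ->; exists (fun=> 0); last by rewrite leey.
  split; last by split=> //; exact: aeW.
  split=> //; exists 1 => //; rewrite /If mul1r integral_cst//= probability_setT mule1.
  apply: (@le_lt_trans _ _ 0%E) => //; apply: ge_ereal_sup => _ [x _ <-].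
  by rewrite mulr0 sub0e oppe_le0 Uhat_ge0.
split.
- exact: sup_norm_closure hU _ A_orlicz A_convex _ _ l1 AX0 dX0.
- exact: sup_dom A_orlicz.
- exact: (sup_weak_closure hU A_orlicz oY.1 Yu).
split.
  exists Y => //; apply/eqP; rewrite eq_le Yu.
  exact: (weak_duality hU A_orlicz oY.1).
by move=> _ [Y' oY' <-]; exact: (weak_duality hU A_orlicz oY'.1).
Qed.

End AbstractDuality.

(** * Attainable wealths form a convex cone *)

Section CadlagPaths.
Context {R : realType} (T : R).
Implicit Types f g : R -> R.

Definition cadlag_path f : Prop := forall t,
  (0 <= t < T -> f s @[s --> t^'+] --> f t) /\
  (0 < t <= T -> cvg (f s @[s --> t^'-])).

Lemma cadlag_path_eq f g : (forall t, 0 <= t <= T -> f t = g t) ->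
  cadlag_path f -> cadlag_path g.
Proof.
move=> fg cf t; have [cr cl] := cf t; split=> [/andP[t0 tT]|/andP[t0 tT]].
  rewrite -fg; last by rewrite t0 ltW.
  apply: (cvg_trans _ (cr _)); last by rewrite t0.
  apply: near_eq_cvg; near=> s; rewrite fg//.
  have ts : t < s by near: s; exact: nbhs_right_gt.
  have sT : s < T by near: s; exact: nbhs_right_lt.
  by rewrite (le_trans t0 (ltW ts)) ltW.
apply/cvg_ex; have /cvg_ex[k hk] := cl (introT andP (conj t0 tT)); exists k.
apply: (cvg_trans _ hk); apply: near_eq_cvg; near=> s; rewrite fg//.
have ts : s < t by near: s; exact: nbhs_left_lt.
have s0 : 0 < s by near: s; exact: nbhs_left_gt.
by rewrite (ltW s0) ltW// (lt_le_trans ts).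
Unshelve. all: by end_near. Qed.

Lemma cadlag_path_cst (c : R) : cadlag_path (fun=> c).
Proof. by move=> t; split=> _; [exact: cvg_cst|exact: is_cvg_cst]. Qed.

Lemma cadlag_pathD f g : cadlag_path f -> cadlag_path g ->
  cadlag_path (fun t => f t + g t).
Proof.
move=> cf cg t; have [fr fl] := cf t; have [gr gl] := cg t; split=> ht.
  by apply: cvgD; [exact: fr|exact: gr].
by apply: is_cvgD; [exact: fl|exact: gl].
Qed.

Lemma cadlag_pathZ (c : R) f : cadlag_path f -> cadlag_path (fun t => c * f t).
Proof.
move=> cf t; have [fr fl] := cf t; split=> ht.
  by apply: cvgM; [exact: cvg_cst|exact: fr].
by apply: is_cvgM; [exact: is_cvg_cst|exact: fl].
Qed.

Lemma cadlag_path_sum (I : Type) (r : seq I) (f : I -> R -> R) :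
  (forall i, cadlag_path (f i)) -> cadlag_path (fun t => \sum_(i <- r) f i t).
Proof.
move=> cf; elim: r => [|i r ih].
  by apply: cadlag_path_eq (cadlag_path_cst 0) => t _; rewrite big_nil.
by apply: cadlag_path_eq (cadlag_pathD (cf i) ih) => t _; rewrite big_cons.
Qed.

Lemma cadlag_path_stop (c : R) f : cadlag_path f -> cadlag_path (fun t => f (Num.min c t)).
Proof.
move=> cf t; have [fr fl] := cf t; split=> /andP[t0 tT].
  have [tc|ct] := ltP t c.
    apply: (cvg_trans _ (fr _)); last by rewrite t0.
    apply: near_eq_cvg; near=> s; rewrite min_r//.
    by apply: ltW; near: s; exact: nbhs_right_lt.
  apply: cvg_near_cst; near=> s; rewrite min_l//.
  by apply: le_trans ct _; apply: ltW; near: s; exact: nbhs_right_gt.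
have [tc|ct] := leP t c.
  have /cvg_ex[k hk] := fl (introT andP (conj t0 tT)); apply/cvg_ex; exists k.
  apply: (cvg_trans _ hk); apply: near_eq_cvg; near=> s; rewrite min_r//.
  by apply: le_trans tc; apply: ltW; near: s; exact: nbhs_left_lt.
apply/cvg_ex; exists (f c); apply: cvg_near_cst; near=> s; rewrite min_l//.
by apply: ltW; near: s; exact: nbhs_left_gt.
Unshelve. all: by end_near. Qed.

(** Each point of the compact [[0, T]] has a neighbourhood on which [f] is bounded, by its one-sided
    limits; at the ends one side contains no time of [[0, T]]. *)
Lemma cadlag_path_bounded f : cadlag_path f ->
  exists M : R, forall t, 0 <= t <= T -> `|f t| <= M.
Proof.
move=> cf; have := @segment_compact R 0 T.
move=> /compact_near_coveringP/(_ R (pinfty_nbhs R)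
  (fun M x => 0 <= x <= T -> `|f x| <= M) _) [].
  move=> x /=; rewrite in_itv/= => /andP[x0 xT]; have [fr fl] := cf x.
  suff [K hK] : exists K : R, \forall y \near x, 0 <= y <= T -> `|f y| <= K.
    exists ([set y | 0 <= y <= T -> `|f y| <= K], [set M | K <= M]).
      by split=> //=; exists K; split; [exact: num_real|move=> ? /ltW].
    by move=> [y M] /= [hy KM] /hy /le_trans; exact.
  have [Kr hKr] : exists K : R, \forall y \near x^'+, 0 <= y <= T -> `|f y| <= K.
    have [xT'|Tx] := ltP x T; last first.
      exists 0; near=> y => /andP[_ yT].
      have : x < y by near: y; exact: nbhs_right_gt.
      by rewrite ltNge (le_trans yT Tx).
    exists (`|f x| + 1); have /cvgr_norm_le := fr (introT andP (conj x0 xT')).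
    move=> /(_ (`|f x| + 1)); rewrite ltrDl ltr01 => /(_ isT).
    by apply: filterS => y h _.
  have [Kl hKl] : exists K : R, \forall y \near x^'-, 0 <= y <= T -> `|f y| <= K.
    have [x0'|x00] := ltP 0 x; last first.
      exists 0; near=> y => /andP[y0 _].
      have : y < x by near: y; exact: nbhs_left_lt.
      by rewrite ltNge (le_trans x00 y0).
    have /cvg_ex[k /cvgr_norm_le hk] := fl (introT andP (conj x0' xT)).
    exists (`|k| + 1); move: hk => /(_ (`|k| + 1)); rewrite ltrDl ltr01 => /(_ isT).
    by apply: filterS => y h _.
  exists (Num.max `|f x| (Num.max Kr Kl)); near=> y => y0T.
  have [yx|xy|->] := ltgtP y x; last by rewrite le_max lexx.
    rewrite !le_max; apply/orP; right; apply/orP; right; move: yx y0T.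
    by near: y; rewrite -near_withinE.
  rewrite !le_max; apply/orP; right; apply/orP; left; move: xy y0T.
  by near: y; rewrite -near_withinE.
move=> M [_ hM]; exists (M + 1) => t t0T.
by apply: (hM (M + 1)) => //; rewrite ?ltrDl//= in_itv.
Unshelve. all: by end_near. Qed.

(** The default value puts [T], which may be irrational, among the times; right continuity does not
    reach it. *)
Definition dense_time (n : nat) : R :=
  if unpickle n is Some q then
    if 0 <= (ratr q : R) <= T then ratr q else T
  else T.

Lemma dense_time_itv n : 0 <= T -> 0 <= dense_time n <= T.
Proof.
move=> T0; rewrite /dense_time; case: (unpickle n) => [q|]; last by rewrite T0 lexx.
by case: ifPn => // _; rewrite T0 lexx.
Qed.

(** By right continuity rational times suffice before [T]. A countable infimum is what makes the
    lowest wealth measurable. *)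
Lemma cadlag_path_inf f : 0 <= T -> cadlag_path f ->
  inf [set f t | t in `[0, T]] = infs (f \o dense_time) 0.
Proof.
move=> T0 cf; have [M hM] := cadlag_path_bounded cf.
have lb : has_lbound [set f t | t in `[0, T]].
  exists (- M) => y [t /=]; rewrite in_itv/= => t0T <-.
  by have := hM t t0T; rewrite ler_norml => /andP[].
have lb' : has_lbound (sdrop (f \o dense_time) 0).
  exists (- M) => _ [n _ <-] /=.
  by have := hM _ (dense_time_itv n T0); rewrite ler_norml => /andP[].
apply/eqP; rewrite eq_le; apply/andP; split.
  apply: lb_le_inf; first by exists (f (dense_time 0)), 0%N.
  move=> _ [n _ <-] /=; apply: ge_inf => //; exists (dense_time n) => //=.
  by rewrite in_itv/= dense_time_itv.
apply: lb_le_inf; first by exists (f 0), 0 => //=; rewrite in_itv/= lexx.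
move=> y [t /=]; rewrite in_itv/= => /andP[t0 tT] <-.
have [tT'|Tt] := ltP t T; last first.
  have -> : t = T by apply/eqP; rewrite eq_le tT.
  (* The rational -1 lies outside [[0, T]], so [dense_time] at its code is [T]. *)
  apply: ge_inf => //; exists (pickle (- 1 : rat)) => //=.
  by rewrite /dense_time pickleK ifF// rmorphN1 lerNr oppr0 ler10.
apply/ler_addgt0Pr => e e0.
have [fr _] := cf t; have /cvgrPdist_lt/(_ _ e0) := fr (introT andP (conj t0 tT')).
move=> /(filterI (nbhs_right_lt tT')).
rewrite /at_right /within/= => /nbhs_ballP[r /= r0 hr].
have tr : t < t + r by rewrite ltrDl.
have [q] := rat_in_itvoo tr; rewrite in_itv/= => /andP[tq qr].
have [|qT fq] := hr (ratr q) _ tq.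
  by rewrite /ball/= ltr_distlC; apply/andP; split; lra.
apply: (@le_trans _ _ (f (ratr q))).
  apply: ge_inf => //; exists (pickle q) => //=.
  by rewrite /dense_time pickleK (le_trans t0 (ltW tq)) (ltW qT).
by move: fq; rewrite ltr_distlC => /andP[_ /ltW].
Qed.

End CadlagPaths.

(** * Regularity of stochastic integrals *)

Section StochasticIntegrals.
Context {R : realType} {dsp : measure_display} {Omega : measurableType dsp}.
Variables (P : probability Omega R) (T : R) (hT : 0 <= T).
Variables (F : R -> set (set Omega)) (hF : filtration T F).
Variables (d : nat) (S : 'I_d -> R -> Omega -> R).
Hypothesis hS : forall j, semimartingale P T F (S j).
Local Notation process := (R -> Omega -> R).
Implicit Types (H : 'I_d -> process) (Z : process).

Let F_measurable t : 0 <= t <= T -> F t `<=` measurable.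
Proof. by move=> /andP[t0 tT]; have [_ Fm <-] := hF; apply: Fm. Qed.

Lemma measurable_wrt_measurable t (X : Omega -> R) : 0 <= t <= T ->
  measurable_wrt (F t) X -> measurable_fun setT X.
Proof.
move=> t0T mX _ B mB; have := mX measurableT B mB; rewrite setTI.
have [Fs _ _] := hF; rewrite /measurable/= sigma_algebra_id; last exact: Fs.
exact: F_measurable.
Qed.

Lemma semimartingale_cadlag j w : cadlag_path T (S j ^~ w).
Proof.
have [_ [M [A [[_ [cM _]] [_ [cA _]] _ SE]]]] := hS j.
apply: (@cadlag_path_eq _ _ (fun t => S j 0 w + M t w + A t w)).
  by move=> t t0T; rewrite -SE.
apply: cadlag_pathD; last by move=> t; exact: cA.
by apply: cadlag_pathD; [exact: cadlag_path_cst|move=> t; exact: cM].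
Qed.

Lemma semimartingale_measurable j t : 0 <= t <= T -> measurable_fun setT (S j t).
Proof.
move=> t0T; have [aS _] := hS j; exact: measurable_wrt_measurable t0T (aS t t0T).
Qed.

(** Limits carry this regularity by definition; elementary integrals inherit it from the stopped
    paths of [S]. *)
Lemma stoch_int_regular H Z : stoch_int P T F S H Z ->
  (forall w, cadlag_path T (Z ^~ w)) /\
  (forall t, 0 <= t <= T -> measurable_fun setT (Z t)).
Proof.
elim=> {H Z} [e|H_ Z_ H Z _ _ _ cZ mZ _]; last by split=> // w t; exact: cZ.
split=> [w|t t0T].
  apply: cadlag_path_sum => j; apply: cadlag_path_sum => p.
  apply: cadlag_pathZ; have cS := semimartingale_cadlag j w.
  apply: (@cadlag_path_eq _ _ (fun t => S j (Num.min (hi p) t) w +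
    -1 * S j (Num.min (lo p) t) w)) => [t _|]; first by rewrite mulN1r.
  apply: cadlag_pathD; last apply: cadlag_pathZ; exact: (@cadlag_path_stop _ _ _ (S j ^~ w)).
apply: measurable_sum => j; apply: measurable_sum => p; have /andP[t0 tT] := t0T.
have mS c : 0 <= c -> measurable_fun setT (S j (Num.min c t)).
  move=> c0; apply: semimartingale_measurable.
  by rewrite le_min c0 t0/= ge_min tT orbT.
have lo0 := lo_ge0 p; have lohi := lo_le_hi p; have hiT := hi_leT p.
apply: measurable_funM; last first.
  by apply: measurable_funB; apply: mS => //; exact: le_trans lohi.
apply: (measurable_wrt_measurable _ (@coef_measurable _ _ _ _ _ p)).
by rewrite lo0 (le_trans lohi).
Qed.

(** Emery convergence tested with the zero integrand controls the initial values, so [Z 0] is a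
    limit in probability of almost surely vanishing variables. *)
Lemma stoch_int_at0 H Z : stoch_int P T F S H Z -> {ae P, forall w, Z 0 w = 0}.
Proof.
elim=> {H Z} [e|H_ Z_ H Z sZ_ ih _ cZ mZ emZ].
  apply: aeW => w; rewrite big1// => j _; apply: big1 => p _.
  rewrite min_r; last exact: le_trans (lo_ge0 p) (lo_le_hi p).
  by rewrite min_r ?(lo_ge0 p)// subrr mulr0.
have T00 : 0 <= (0 : R) <= T by rewrite lexx hT.
have mZ0 := mZ 0 T00.
pose B (c : R) := [set w | c < `|Z 0 w|].
have mB c : measurable (B c).
  have mN : measurable_fun setT (fun w => `|Z 0 w|) by exact: measurableT_comp.
  rewrite -[B c]setTI.
  exact: (measurable_fun_ltr (measurable_cst c) mN measurableT (Y := [set true])).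
have PB c : 0 < c -> (P (B c) <= c%:E)%E.
  move=> c0; have [n _ /(_ n (leqnn n))] := emZ _ c0.
  move=> /(_ [::]) []; first by move=> t w; rewrite /elem_process big_nil normr0.
  move=> A [mA PA hA]; have [N [mN PN hN]] := ih n.
  apply: (@le_trans _ _ (P (A `|` N))).
    apply: le_measure; rewrite ?inE//; first exact: measurableU.
    move=> w Bw; have [Nw|Nw] := pselect (N w); [by right|left].
    apply: (hA 0 w T00); rewrite /elem_integral big_nil addr0.
    have -> : Z_ n 0 w = 0 by apply: contrapT => h; apply: Nw; exact: hN.
    by rewrite sub0r normrN.
  by rewrite measureU0.
(* [B c] grows as [c] decreases, so its probability is below every positive level. *)
have PB0 c : 0 < c -> P (B c) = 0%E.
  move=> c0; apply/eqP; rewrite eq_le measure_ge0 andbT.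
  apply/lee_addgt0Pr => e e0; rewrite add0e.
  have m0 : 0 < Num.min c e by rewrite lt_min c0.
  apply: (@le_trans _ _ (P (B (Num.min c e)))).
    apply: le_measure; rewrite ?inE// => w; apply: le_lt_trans.
    by rewrite ge_min lexx.
  by apply: le_trans (PB _ m0) _; rewrite lee_fin ge_min lexx orbT.
have aeB : {ae P, forall w n, ~ B n.+1%:R^-1 w}.
  apply/ae_foralln => n; exists (B n.+1%:R^-1); split=> //; first exact: PB0.
  by move=> w /= /contrapT.
apply: filterS aeB => w Bw; apply/eqP; rewrite -normr_le0 leNgt; apply/negP.
by move=> /ltr_add_invr[n]; rewrite add0r; exact: Bw.
Qed.

End StochasticIntegrals.

(** * Linearity of the stochastic integral and convexity of the attainable set *)

Section WealthCone.
Context {R : realType} {dsp : measure_display} {Omega : measurableType dsp}.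
Variables (P : probability Omega R) (T : R) (hT : 0 <= T).
Variables (F : R -> set (set Omega)) (hF : filtration T F).
Variables (d : nat) (S : 'I_d -> R -> Omega -> R).
Hypothesis hS : forall j, semimartingale P T F (S j).
Local Notation process := (R -> Omega -> R).
Implicit Types (H : 'I_d -> process) (Z : process) (c a b : R).

Section ScaledTerm.
Variables (c : R) (p : elem_term T F).

Let scaled_coef_measurable : measurable_wrt (F (lo p)) (fun w => c * coef p w).
Proof. by apply: measurable_funM => //; exact: (@coef_measurable _ _ _ _ _ p). Qed.

Let scaled_coef_bounded : exists C : R, forall w, `|c * coef p w| <= C.
Proof.
by have [C hC] := coef_bounded p; exists (`|c| * C) => w; rewrite normrM ler_wpM2l.
Qed.

Definition scaled_term : elem_term T F :=
  ElemTerm (lo_ge0 p) (lo_le_hi p) (hi_leT p) scaled_coef_measurable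
    scaled_coef_bounded.

End ScaledTerm.

Lemma elem_integralB (e : seq (elem_term T F)) (X X' : process) c t w :
  elem_integral e (fun s v => c * X s v - c * X' s v) t w =
  c * elem_integral e (fun s v => X s v - X' s v) t w.
Proof. by rewrite /elem_integral mulr_sumr; apply: eq_bigr => p _; ring. Qed.

Lemma stoch_intZ c H Z : stoch_int P T F S H Z ->
  stoch_int P T F S (fun j t w => c * H j t w) (fun t w => c * Z t w).
Proof.
elim=> {H Z} [e|H_ Z_ H Z sZ_ ih cH cZ mZ emZ].
  rewrite (_ : (fun j t w => c * _) =
    fun j => elem_process [seq scaled_term c p | p <- e j]); last first.
    apply/funext => j; apply/funext => t; apply/funext => w.
    rewrite /elem_process big_map mulr_sumr; apply: eq_bigr => p _ /=.
    by case: ifP; rewrite ?mulr0.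
  rewrite (_ : (fun t w => c * _) = fun t w =>
      \sum_(j < d) elem_integral [seq scaled_term c p | p <- e j] (S j) t w).
    exact: stoch_int_elem.
  apply/funext => t; apply/funext => w; rewrite mulr_sumr; apply: eq_bigr => j _.
  rewrite /elem_integral big_map mulr_sumr; apply: eq_bigr => p _ /=.
  by rewrite mulrA.
apply: stoch_int_lim ih _ _ _ _.
- by move=> j t w t0T; apply: cvgM; [exact: cvg_cst|exact: cH].
- by move=> w; apply: cadlag_pathZ => t; exact: cZ.
- by move=> t t0T; apply: measurable_funM => //; exact: mZ.
move=> e e0; have c1 : 0 < `|c| + 1 by rewrite ltr_wpDl.
(* This level is at most [e], which bounds [P A], and [|c|] times it is at most [e], which bounds
   the scaled integral; the [+ 1] allows [c = 0]. *)
have e1 : 0 < e / (`|c| + 1) by rewrite divr_gt0.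
have ce : e / (`|c| + 1) <= e by rewrite ler_pdivrMr// ler_peMr ?(ltW e0)// lerDr.
have := emZ _ e1; apply: filterS => n hn f hf.
have [A [mA PA hA]] := hn f hf; exists A; split=> //.
  by apply: le_trans PA _; rewrite lee_fin.
move=> t w t0T h; apply: (hA t w t0T); rewrite ltNge; apply/negP => h'.
move: h; rewrite elem_integralB -mulrBr -mulrDr normrM ltNge => /negP; apply.
apply: (@le_trans _ _ (`|c| * (e / (`|c| + 1)))); first exact: ler_wpM2l.
by rewrite mulrCA ler_piMr ?(ltW e0)// ler_pdivrMr// mul1r lerDl.
Qed.

Lemma emery_cvg_shift (Z_ : nat -> process) Z Z' : emery_cvg P T F Z_ Z ->
  emery_cvg P T F (fun n t w => Z_ n t w + Z' t w) (fun t w => Z t w + Z' t w).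
Proof.
move=> h e e0; have := h e e0; apply: filterS => n hn f hf.
have [A [mA PA hA]] := hn f hf; exists A; split=> // t w t0T.
have -> : (fun s v => Z_ n s v + Z' s v - (Z s v + Z' s v)) =
    (fun s v => Z_ n s v - Z s v).
  by apply/funext => s; apply/funext => v; ring.
have -> : Z_ n 0 w + Z' 0 w - (Z 0 w + Z' 0 w) = Z_ n 0 w - Z 0 w by ring.
exact: hA.
Qed.

(** Double induction: limits in the first integral are taken with the second one fixed; for an
    elementary first integral, limits are taken in the second. Elementary integrands add by
    concatenation of their lists. *)
Lemma stoch_intD H Z H' Z' : stoch_int P T F S H Z -> stoch_int P T F S H' Z' ->
  stoch_int P T F S (fun j t w => H j t w + H' j t w) (fun t w => Z t w + Z' t w).
Proof.
move=> sZ; elim: sZ H' Z' => {H Z} [e|H_ Z_ H Z sZ_ ih cH cZ mZ emZ] H' Z'; last first.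
  move=> sZ'; have [cZ' mZ'] := stoch_int_regular hF hS sZ'.
  apply: (stoch_int_lim (fun n => ih n _ _ sZ')).
  - by move=> j t w t0T; apply: cvgD; [exact: cH|exact: cvg_cst].
  - by move=> w; apply: cadlag_pathD => t; [exact: cZ|exact: cZ'].
  - by move=> t t0T; apply: measurable_funD; [exact: mZ|exact: mZ'].
  - exact: emery_cvg_shift.
elim=> {H' Z'} [e'|H_ Z_ H Z sZ_ ih cH cZ mZ emZ].
  rewrite (_ : (fun j t w => _ + _) = fun j => elem_process (e j ++ e' j)); last first.
    apply/funext => j; apply/funext => t; apply/funext => w.
    by rewrite /elem_process big_cat.
  rewrite (_ : (fun t w => _ + _) = fun t w =>
      \sum_(j < d) elem_integral (e j ++ e' j) (S j) t w).
    exact: stoch_int_elem.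
  apply/funext => t; apply/funext => w; rewrite -big_split; apply: eq_bigr => j _.
  by rewrite /elem_integral big_cat.
have [cZ' mZ'] := stoch_int_regular hF hS (stoch_int_elem P S e).
apply: stoch_int_lim ih _ _ _ _.
- by move=> j t w t0T; apply: cvgD; [exact: cvg_cst|exact: cH].
- by move=> w; apply: cadlag_pathD => t; [exact: cZ'|exact: cZ].
- by move=> t t0T; apply: measurable_funD; [exact: mZ'|exact: mZ].
- have := emery_cvg_shift (fun t w => \sum_(j < d) elem_integral (e j) (S j) t w) emZ.
  by congr emery_cvg; do ?[apply/funext => ?]; rewrite addrC.
Qed.

Lemma integral_of_linear a b H Z H' Z' :
  integral_of P T F S H Z -> integral_of P T F S H' Z' ->
  integral_of P T F S (fun j t w => a * H j t w + b * H' j t w)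
    (fun t w => a * Z t w + b * Z' t w).
Proof.
move=> [pH sZ] [pH' sZ']; split; last by apply: stoch_intD; exact: stoch_intZ.
by move=> j; apply: measurable_funD; apply: measurable_funM => //; [exact: pH|exact: pH'].
Qed.

Variables (U : R -> \bar R).
Hypothesis hU : utility U.

(** The infimum of [a Z + b Z'] is at least [a inf Z + b inf Z'], and almost surely at most 0 since
    the integrals start at 0. Its absolute value is thus dominated by that of an element of the
    Orlicz space. *)
Lemma tame_cone a b H Z H' Z' : 0 <= a -> 0 <= b ->
  tame P T F S U H Z -> tame P T F S U H' Z' ->
  tame P T F S U (fun j t w => a * H j t w + b * H' j t w)
    (fun t w => a * Z t w + b * Z' t w).
Proof.
move=> a0 b0 [iH oZ] [iH' oZ']; have iHH := integral_of_linear a b iH iH'.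
split=> //.
have [cZ mZ] := stoch_int_regular hF hS iH.2.
have [cZ' mZ'] := stoch_int_regular hF hS iH'.2.
have [cZZ mZZ] := stoch_int_regular hF hS iHH.2.
have lb f : cadlag_path T f -> has_lbound [set f t | t in `[0, T]].
  move=> /cadlag_path_bounded [M hM]; exists (- M) => y [t /=].
  rewrite in_itv/= => t0T <-.
  by have := hM t t0T; rewrite ler_norml => /andP[].
have T00 : 0 <= (0 : R) <= T by rewrite lexx hT.
apply: (orlicz_le hU (orliczD hU (orliczZ hU a oZ) (orliczZ hU b oZ'))).
  under eq_fun do rewrite (cadlag_path_inf hT (cZZ _)).
  apply: measurable_fun_infs => [w _|n].
    have [M hM] := cadlag_path_bounded (cZZ w); exists (- M) => _ [n _ <-] /=.
    by have := hM _ (dense_time_itv n hT); rewrite ler_norml => /andP[].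
  by apply: mZZ; exact: dense_time_itv.
have := stoch_int_at0 hT iH.2; have := stoch_int_at0 hT iH'.2.
apply: filterS2 => w Z'0 Z0.
set I := inf _; set J := (_ \+ _) w.
have JI : J <= I.
  apply: lb_le_inf.
    by exists (a * Z 0 w + b * Z' 0 w), 0 => //=; rewrite in_itv.
  move=> y [t t0T <-]; apply: lerD; apply: ler_wpM2l => //; apply: ge_inf.
  - exact: lb (cZ w).
  - by exists t.
  - exact: lb (cZ' w).
  - by exists t.
have I0 : I <= 0.
  apply: ge_inf; first exact: lb (cZZ w).
  by exists 0 => /=; [rewrite in_itv|rewrite Z0 Z'0 !mulr0 addr0].
by rewrite !ler0_norm ?lerN2//; exact: le_trans I0.
Qed.

Lemma attainable_convex X X' (t : R) : 0 <= t <= 1 ->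
  attainable P T F S U X -> attainable P T F S U X' ->
  attainable P T F S U (fun w => (1 - t) * X w + t * X' w).
Proof.
move=> /andP[t0 t1] [oX [K [N [[H [Z [tZ ->]]] [mN N0] XE]]]].
move=> [oX' [K' [N' [[H' [Z' [tZ' ->]]] [mN' N0'] XE']]]].
split; first by apply: (orliczD hU); exact: orliczZ.
have t1' : 0 <= 1 - t by rewrite subr_ge0.
exists (fun w => (1 - t) * Z T w + t * Z' T w), (fun w => (1 - t) * N w + t * N' w).
split.
- exists (fun j s w => (1 - t) * H j s w + t * H' j s w).
  by exists (fun s w => (1 - t) * Z s w + t * Z' s w); split=> //; exact: tame_cone.
- split; first by apply: measurable_funD; exact: measurable_funM.
  by apply: filterS2 N0 N0' => w h h'; rewrite addr_ge0// mulr_ge0.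
- by rewrite XE XE'; apply/funext => w /=; ring.
Qed.

End WealthCone.

Theorem theorem2p1 (R : realType) (dsp : measure_display)
    (Omega : measurableType dsp) (P : probability Omega R)
    (T : R) (hT : 0 <= T)
    (F : R -> set (set Omega)) (hF : filtration T F)
    (d : nat) (S : 'I_d -> R -> Omega -> R)
    (hS : forall j, semimartingale P T F (S j))
    (U : R -> \bar R) (hU : utility U)
    (B : Omega -> R) (hB : orlicz P (Uhat U) B)
    (A : set (Omega -> R))
    (hA : A = [set B \+ X | X in attainable P T F S U])
    (hcore : A `&` coreI P U !=set0) :
  let u := ereal_sup [set If P U X | X in A] in
  [/\ u = ereal_sup [set If P U X | X in norm_closure P (Uhat U) A],
      u = ereal_sup [set If P U X | X in A `&` domI P U],
      u = ereal_sup [set If P U X |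
            X in weak_closure P (Uhat U) (Vhat U) (A `&` domI P U)]
    & is_min [set (If P (conjV U) Y + support_fun P (A `&` domI P U) Y)%E |
            Y in orlicz_plus P (Vhat U)] u].
Proof.
(* The market enters through the convexity of [A] and its inclusion in the Orlicz space. *)
apply: convex_utility_duality => //.
- by rewrite hA => _ [X [oX _] <-]; exact: orliczD.
- move=> X Y t t01; rewrite hA => -[X' aX' <-] [Y' aY' <-].
  exists (fun w => (1 - t) * X' w + t * Y' w).
    exact: (attainable_convex hT hF hS hU t01 aX' aY').
  by apply/funext => w /=; ring.
Qed.
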